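(* Let $\varepsilon>0$, $C_0<\infty$, $B>0$ and $\sigma^2>0$ be fixed. Then there exist constants $0<c<C<\infty$, depending only on $\sigma^2$, $\varepsilon$ and $C_0$, and an integer $n_0$, depending only on $B$, $\sigma^2$, $\varepsilon$ and $C_0$, such that, for all $n\geqslant n_0$, every integer $s=s_n$ satisfying $$(1+\varepsilon)\log_2n\leqslant s\leqslant C_0\log_2n,$$ and every integer $d\geqslant s$, the class $\mathcal M_{d,B,s}$ of coordinatewise nondecreasing functions $f:\{0,1\}^d\to[0,1]$ with $I^{(2)}(f)\leqslant B$ and $|\operatorname{supp}(f)|\leqslant s$ satisfies $$c\,\frac Bs\leqslant R_n^*(\mathcal M_{d,B,s})\leqslant C\left(\frac Bs+\frac{\log\binom ds}{n}\right).$$ The upper bound is attained by the model-selection projection estimator $\widehat f_{s,D}$ (described in the context) with $D=\lfloor\eta s\rfloor$ for a suitable sufficiently small constant $\eta\in(0,1/2)$ depending only on $C_0$. Consequently, if $\log\binom ds\leqslant A_1\frac{nB}{s}$ for some fixed constant $A_1<\infty$, then $$R_n^*(\mathcal M_{d,B,s})\asymp\frac Bs,$$ where $\asymp$ means equality up to positive multiplicative constants depending only on $\sigma^2$, $\varepsilon$, $C_0$ and $A_1$ (for all $n\geqslant n_0$).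
   Context: Model. One observes $Y_j=f(X_j)+\varepsilon_j$, $j=1,\dots,n$, where $X_1,\dots,X_n$ are i.i.d. uniform on $\{0,1\}^d$ (law $\mu$), and $\varepsilon_1,\dots,\varepsilon_n$ are i.i.d., centered, independent of the design, with $\mathbb E e^{t\varepsilon_j}\leqslant\exp(\sigma^2t^2/2)$ for all $t\in\mathbb R$. (The noise variables $\varepsilon_j$ are not to be confused with the constant $\varepsilon$.) Let $\mathcal P_{\sigma^2}$ be the class of all such noise laws. Risk. $\|g\|_2^2=2^{-d}\sum_{x\in\{0,1\}^d}g(x)^2$. For an estimator $\widehat f$ based on $(X_j,Y_j)_{j=1}^n$, $R_{P_\varepsilon}(\widehat f,f)=\mathbb E\|\widehat f-f\|_2^2$, expectation over design and noise with noise law $P_\varepsilon$. For a class $\mathcal A$, $R_n^*(\mathcal A)=\inf_{\widehat f}\sup_{f\in\mathcal A}\sup_{P_\varepsilon\in\mathcal P_{\sigma^2}}R_{P_\varepsilon}(\widehat f,f)$, the infimum being over all estimators based on the sample. ''The upper bound is attained by $\widehat f$'' means that $\sup_{f\in\mathcal A}\sup_{P_\varepsilon\in\mathcal P_{\sigma^2}}R_{P_\varepsilon}(\widehat f,f)$ satisfies the stated upper bound. Notation. For $x\in\{0,1\}^d$, $x^{i\to a}$ is $x$ with $i$-th coordinate replaced by $a$; $\Delta_if(x)=f(x^{i\to1})-f(x^{i\to0})$; $\operatorname{supp}(f)=\{i\in[d]:\Delta_if\not\equiv0\}$, where $[d]=\{1,\dots,d\}$. For $S\subseteq[d]$, $\chi_S(x)=\prod_{i\in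 S}(2x_i-1)$, $\chi_\emptyset\equiv1$, $\widehat f(S)=\mathbb E[f(X)\chi_S(X)]$ with $X\sim\mu$. The Fourier--Sobolev energy is $I^{(2)}(f)=4\sum_{S\ne\emptyset}|S|\widehat f(S)^2=\sum_{i=1}^d\mathbb E[(\Delta_if(X))^2]$. Model-selection estimator $\widehat f_{s,D}$ ($0\leqslant D\leqslant s$). Split the sample into a first half of size $\lfloor n/2\rfloor$ and a second half of size $n-\lfloor n/2\rfloor$. For each $J\subseteq[d]$ with $|J|=s$, let $\widehat f_J$ be the function $\sum_{S\subseteq J,|S|\leqslant D}\widetilde f(S)\chi_S$ clipped pointwise to $[0,1]$ (via $t\mapsto\max(0,\min(t,1))$), where $\widetilde f(S)$ is the average of $Y_j\chi_S(X_j)$ over the first half. Let $\widehat J$ minimize over $|J|=s$ the empirical squared loss (the average of $(Y_j-\widehat f_J(X_j))^2$ over the second half), and set $\widehat f_{s,D}=\widehat f_{\widehat J}$. *)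

(* Defs.v *)
From HB Require Import structures.
From mathcomp Require Import all_boot all_order all_algebra.
From mathcomp Require Import all_classical all_reals all_analysis.

Set Implicit Arguments.
Unset Strict Implicit.
Unset Printing Implicit Defensive.

Import Order.TTheory GRing.Theory Num.Theory.
Import numFieldNormedType.Exports.

Local Open Scope ring_scope.

Notation cube d := {ffun 'I_d -> bool}.

Definition log2 (R : realType) (x : R) : R := ln x / ln 2.

Section BooleanCube.
Context {R : realType} {d : nat}.
Implicit Types (f g : cube d -> R) (x y : cube d) (S : {set 'I_d}).

Definition set_coord x (i : 'I_d) (a : bool) : cube d :=
  [ffun j => if j == i then a else x j].

Definition Delta (i : 'I_d) f x : R :=
  f (set_coord x i true) - f (set_coord x i false).

Definition supp f : {set 'I_d} := finset (fun i => [exists x, Delta i f x != 0]).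

Definition cube_mean f : R := (2 ^+ d)^-1 * \sum_(x : cube d) f x.

Definition norm2_sq g : R := cube_mean (fun x => g x ^+ 2).

Definition chi S x : R := \prod_(i in S) (2 * (x i)%:R - 1).

Definition fourier_coef f S : R := cube_mean (fun x => f x * chi S x).

Definition fourier_sobolev f : R :=
  4 * \sum_(S : {set 'I_d} | S != finset.set0) #|S|%:R * fourier_coef f S ^+ 2.

Definition coord_nondecreasing f : Prop :=
  forall x y, (forall i, (x i <= y i)%N) -> f x <= f y.

End BooleanCube.

Local Open Scope classical_set_scope.

Definition monotone_class (R : realType) (d : nat) (B : R) (s : nat) :
    set (cube d -> R) :=
  [set f | [/\ coord_nondecreasing f, (forall x, 0 <= f x <= 1),
               fourier_sobolev f <= B & (#|supp f| <= s)%N]].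

Section IidLaw.
Context {R : realType}.

Definition cons_pair n (p : R * n.-tuple R) : n.+1.-tuple R :=
  [the n.+1.-tuple R of p.1 :: p.2].

Lemma measurable_cons_pair n : measurable_fun [set: R * n.-tuple R] (@cons_pair n).
Proof. exact: measurable_cons. Qed.

HB.instance Definition _ n :=
  isMeasurableFun.Build _ _ _ _ (@cons_pair n) (@measurable_cons_pair n).

(* The n-fold product measure of P; see iid_law_rect below. *)
Fixpoint iid_law (P : probability R R) (n : nat) : probability (n.-tuple R) R :=
  match n return probability (n.-tuple R) R with
  | 0 => dirac ([tuple] : 0.-tuple R)
  | m.+1 => distribution (product_measure1 P (iid_law P m)) (@cons_pair m)
  end.

Local Open Scope ereal_scope.

Lemma measurable_rect n (A : 'I_n -> set R) : (forall i, measurable (A i)) ->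
  measurable [set y : n.-tuple R | forall i, A i (tnth y i)].
Proof.
move=> mA.
have -> : [set y : n.-tuple R | forall i, A i (tnth y i)] =
    \bigcap_(i in [set: 'I_n]) ((@tnth n R ^~ i) @^-1` A i).
  by apply/seteqP; split=> [y Ay i _|y Ay i]; exact: Ay.
apply: fin_bigcap_measurable => // i _.
by rewrite -[X in measurable X]setTI; exact: measurable_tnth.
Qed.

Lemma iid_law_rect (P : probability R R) n (A : 'I_n -> set R) :
  (forall i, measurable (A i)) ->
  iid_law P n [set y : n.-tuple R | forall i, A i (tnth y i)] =
  \prod_(i < n) P (A i).
Proof.
elim: n A => [|n IH] A mA /=.
  by rewrite big_ord0 diracE mem_set//= => -[].
rewrite big_ord_recl -IH; last by move=> i; exact: mA.
rewrite -product_measure1E; [|exact: mA|]; last first.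
  exact: (measurable_rect (fun i => mA (lift ord0 i))).
rewrite /distribution /pushforward; congr (_ _).
apply/seteqP; split=> -[y0 y] /=.
  move=> Ay; split=> [|i]; first exact: (Ay ord0).
  by have := Ay (lift ord0 i); rewrite tnthS.
move=> [Ay0 Ay] i; case: (unliftP ord0 i) => [j ->|->]; last exact: Ay0.
by rewrite tnthS; exact: Ay.
Qed.

End IidLaw.

Section Regression.
Context {R : realType}.

Definition noise_class (sigma2 : R) : set (probability R R) :=
  [set P : probability R R |
    [/\ P.-integrable setT (fun e : R => e%:E),
        ('E_P[@idfun R] = 0)%E &
        forall t : R,
          ('M_P (@idfun R) t <= (expR (sigma2 * t ^+ 2 / 2))%:E)%E]].

Definition estimator n d := n.-tuple (cube d) -> n.-tuple R -> cube d -> R.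

Definition is_estimator n d : set (estimator n d) :=
  [set fhat | forall (X : n.-tuple (cube d)) (x : cube d),
     measurable_fun [set: n.-tuple R] (fun Y => fhat X Y x)].

Definition responses n d (f : cube d -> R) (X : n.-tuple (cube d))
    (e : n.-tuple R) : n.-tuple R :=
  [tuple f (tnth X j) + tnth e j | j < n].

Local Open Scope ereal_scope.

(* The expectation over the uniform design is the average over the 2^(d n)
   equally likely designs, the noise being independent of the design. *)
Definition risk n d (P : probability R R) (fhat : estimator n d)
    (f : cube d -> R) : \bar R :=
  ((2 ^+ (d * n))^-1)%:E * \sum_(X : n.-tuple (cube d))
    \int[iid_law P n]_e
      (norm2_sq (fun x => fhat X (responses f X e) x - f x)%R)%:E.

Definition worst_risk (sigma2 : R) n d (A : set (cube d -> R))
    (fhat : estimator n d) : \bar R :=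
  ereal_sup [set ereal_sup [set risk P fhat f | P in noise_class sigma2]
            | f in A].

Definition minimax_risk (sigma2 : R) n d (A : set (cube d -> R)) : \bar R :=
  ereal_inf [set worst_risk sigma2 A fhat | fhat in @is_estimator n d].

End Regression.

Section ModelSelection.
Context {R : realType} {n d : nat}.
Implicit Types (X : n.-tuple (cube d)) (Y : n.-tuple R) (J S : {set 'I_d}).

Definition empirical_coef X Y S : R :=
  (n./2)%:R^-1 *
  \sum_(j < n | (j < n./2)%N) tnth Y j * chi S (tnth X j).

Definition clip01 (t : R) : R := Num.max 0 (Num.min t 1).

Definition proj_estimator (D : nat) J : estimator n d := fun X Y x =>
  clip01 (\sum_(S : {set 'I_d} | (S \subset J) && (#|S| <= D)%N)
            empirical_coef X Y S * chi S x).

Definition validation_loss D J X Y : R :=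
  (n - n./2)%N%:R^-1 *
  \sum_(j < n | (n./2 <= j)%N)
    (tnth Y j - proj_estimator D J X Y (tnth X j)) ^+ 2.

(* Jhat is an arbitrary measurable choice of a minimizer, so that no particular
   rule for breaking ties is imposed. *)
Definition is_selector (s D : nat)
    (Jhat : n.-tuple (cube d) -> n.-tuple R -> {set 'I_d}) : Prop :=
  [/\ (forall X J, measurable [set Y | Jhat X Y = J]),
      (forall X Y, #|Jhat X Y| = s) &
      (forall X Y J, #|J| = s ->
         validation_loss D (Jhat X Y) X Y <= validation_loss D J X Y)].

Definition model_selection_estimator (D : nat)
    (Jhat : n.-tuple (cube d) -> n.-tuple R -> {set 'I_d}) : estimator n d :=
  fun X Y => proj_estimator D (Jhat X Y) X Y.

End ModelSelection.

(* Main.v *)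
Require Import Defs.
From HB Require Import structures.
From mathcomp Require Import all_boot all_order all_algebra.
From mathcomp Require Import all_classical all_reals all_analysis.
From mathcomp Require Import measurable_realfun zify ring lra.
Set Implicit Arguments.
Unset Strict Implicit.
Unset Printing Implicit Defensive.
Import Order.TTheory GRing.Theory Num.Theory.
Import numFieldNormedType.Exports.
Local Open Scope classical_set_scope.
Local Open Scope ring_scope.

(** Upper bound.  Let J0 be a set of s coordinates containing the support of f.
Among the functions of the coordinates in J0, projecting on degree at most D
costs a squared bias of at most I(f) / (4 (D + 1)), because the energy I(f)
weighs the Fourier mass at S by 4 |S| ([projection_error]).  With
D = floor (eta s) this is of order B / s.  The price of estimating the
remaining coefficients is their number divided by n; since s is at most a
constant times log n, a small eta keeps that number below sqrt n
([low_degree_dimension]), so the variance is negligible against B / s.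

The set J is chosen on the second half of the sample; given the first half, the
candidate errors g_J are fixed functions with values in [-1, 1].  For such a g, the difference of the empirical losses of f + g and f is the sum of the
independent terms g(X)^2 - 2 e g(X), whose exponential moments at a small
constant lam show that it is rarely below a quarter, or above three times, its
mean m |g|^2 ([excess_below_mgf], [excess_above_mgf]).  The inequality w <= e^w
turns these moments into a pointwise bound of the loss of the selected
candidate by nonnegative quantities of known expectation
([selection_pointwise]); the C(d, s) candidates enter only through
ln C(d, s) / n.  This gives the oracle inequality [model_selection_risk].
Second moments, too, are controlled by exponential ones, so that the noise
always enters through the bound on its moment generating function.

Lower bound.  Take zero noise.  On s chosen coordinates, let f vanish below the
middle layer, equal a above it, and take arbitrary values in {0, a} on it: all
these functions are monotone.  Only edges with an endpoint in the layer
contribute to the energy, so it is at most 2 s p a^2, where p is the mass of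
the layer, and a^2 = B / (2 s p) is allowed; this is at most 1 because p is at
least of order s^(-1/2) ([central_bin_lower]).  As 2^s >= 2 n, each point of
the layer is unobserved with probability at least 1/2, and flipping the value
there does not change the data.  Averaging over all values on the layer, every
estimator loses at least a^2 p / 8 = B / (16 s) ([hard_instance]). *)

(** * Fourier analysis on the cube *)

Section Fourier.
Context {R : realType} {d : nat}.
Implicit Types (f g : cube d -> R) (x y : cube d) (S T J : {set 'I_d}) (i : 'I_d).

Let dpos : 0 < (2 ^+ d : R). Proof. by rewrite exprn_gt0. Qed.

Lemma cube_mean_ext f g : f =1 g -> cube_mean f = cube_mean g.
Proof. by move=> e; rewrite /cube_mean; under eq_bigr do rewrite e. Qed.

Lemma cube_mean_le f g : (forall x, f x <= g x) -> cube_mean f <= cube_mean g.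
Proof. by move=> h; rewrite ler_pM2l ?invr_gt0//; apply: ler_sum. Qed.

Lemma cube_mean_ge0 f : (forall x, 0 <= f x) -> 0 <= cube_mean f.
Proof. by move=> h; apply: mulr_ge0; [rewrite invr_ge0 ltW|apply: sumr_ge0]. Qed.

Lemma cube_mean_cst (a : R) : cube_mean (fun _ : cube d => a) = a.
Proof.
rewrite /cube_mean sumr_const card_ffun card_bool card_ord -[a *+ _]mulr_natl natrX.
by rewrite mulrA mulVf ?mul1r// gt_eqF.
Qed.

Lemma cube_mean_bounds (a b : R) f :
  (forall x, a <= f x <= b) -> a <= cube_mean f <= b.
Proof.
move=> fab; rewrite -(cube_mean_cst a) -[b]cube_mean_cst.
by apply/andP; split; apply: cube_mean_le => x; case/andP: (fab x).
Qed.

Lemma cube_meanD f g : cube_mean (fun x => f x + g x) = cube_mean f + cube_mean g.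
Proof. by rewrite /cube_mean big_split mulrDr. Qed.

Lemma cube_meanZ (a : R) f : cube_mean (fun x => a * f x) = a * cube_mean f.
Proof. by rewrite /cube_mean -mulr_sumr mulrCA. Qed.

Lemma cube_mean_sum (I : Type) (r : seq I) (P : pred I) (F : I -> cube d -> R) :
  cube_mean (fun x => \sum_(i <- r | P i) F i x) =
  \sum_(i <- r | P i) cube_mean (F i).
Proof. by rewrite /cube_mean exchange_big mulr_sumr. Qed.

Lemma cube_mean_reindex (h : cube d -> cube d) f :
  involutive h -> cube_mean (fun x => f (h x)) = cube_mean f.
Proof.
move=> hK; rewrite /cube_mean; congr (_ * _).
by rewrite [RHS](reindex h)//; exists h => y _; exact: hK.
Qed.

Definition sgb (b : bool) : R := 2 * b%:R - 1.

Lemma sgbT : sgb true = 1. Proof. by rewrite /sgb mulr1 addrK. Qed.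

Lemma sgbF : sgb false = -1. Proof. by rewrite /sgb mulr0 sub0r. Qed.

Lemma sgb_sq b : sgb b * sgb b = 1.
Proof. by case: b; rewrite ?sgbT ?sgbF; ring. Qed.

Lemma chiE S x : chi S x = \prod_i (if i \in S then sgb (x i) else 1) :> R.
Proof. by rewrite /chi big_mkcond. Qed.

Lemma chi_sq S x : chi S x * chi S x = 1 :> R.
Proof. by rewrite /chi -big_split big1// => i _; exact: sgb_sq. Qed.

(** Completeness of the characters.  Parseval's identity follows from this dual
orthogonality alone, by expanding the squares of the coefficients. *)
Lemma chi_dual x y :
  \sum_S chi S x * chi S y = 2 ^+ d * (x == y)%:R :> R.
Proof.
transitivity (\prod_i (sgb (x i) * sgb (y i) + 1) : R).
  rewrite bigA_distr; apply: eq_bigr => S _; rewrite !chiE -big_split.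
  by apply: eq_bigr => i _ /=; case: ifP; rewrite ?mulr1.
have [->|neq] := eqVneq x y.
  rewrite (eq_bigr (fun=> 2%:R)) ?prodr_const ?card_ord ?mulr1// => i _.
  by rewrite sgb_sq.
have [i xyi] : exists i, x i != y i.
  by apply/existsP; apply: contraR neq => /existsPn h; apply/eqP/ffunP => i;
     apply/eqP; rewrite -[_ == _]negbK; exact: h.
rewrite mulr0 (bigD1 i)//=.
have -> : sgb (x i) * sgb (y i) + 1 = 0.
  by move: xyi; case: (x i); case: (y i) => // _; rewrite sgbT sgbF; ring.
by rewrite mul0r.
Qed.

Lemma chi_orth S T : cube_mean (fun x => chi S x * chi T x) = (S == T)%:R :> R.
Proof.
have [->|neq] := eqVneq S T.
  rewrite (@cube_mean_ext _ (fun=> 1)) ?cube_mean_cst//.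
  by move=> x; exact: chi_sq.
rewrite /cube_mean.
have -> : \sum_x chi S x * chi T x =
   \sum_(x : cube d) \prod_i ((if i \in S then sgb (x i) else 1) *
      (if i \in T then sgb (x i) else 1)).
  by apply: eq_bigr => x _; rewrite !chiE -big_split.
have [i iST] : exists i, (i \in S) != (i \in T).
  by apply/existsP; apply: contraR neq => /existsPn h; apply/eqP/setP => i;
     apply/eqP; rewrite -[_ == _]negbK; exact: h.
rewrite -(bigA_distr_bigA (fun i (b : bool) =>
   (if i \in S then sgb b else 1) * (if i \in T then sgb b else 1))).
rewrite (bigD1 i)//= [X in _ * (X * _)](_ : _ = 0) ?mul0r ?mulr0//.
rewrite big_bool /=.
by move: iST; rewrite sgbT sgbF; case: (i \in S); case: (i \in T) => // _; ring.
Qed.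

Lemma parseval g : norm2_sq g = \sum_S fourier_coef g S ^+ 2.
Proof.
rewrite /fourier_coef /norm2_sq /cube_mean.
transitivity ((2 ^+ d)^-1 * ((2 ^+ d)^-1 * \sum_x \sum_y
     g x * g y * \sum_S chi S x * chi S y) : R).
  congr (_ * _); rewrite mulr_sumr; apply: eq_bigr => x _.
  rewrite (bigD1 x)//= [X in _ + X]big1 ?addr0; last first.
    move=> y yx; rewrite chi_dual eq_sym (negbTE yx) !mulr0 //.
  rewrite chi_dual eqxx mulr1 mulrCA mulVf ?gt_eqF// mulr1.
  by [].
rewrite mulrA -expr2.
under [RHS]eq_bigr do rewrite exprMn.
rewrite -mulr_sumr; congr (_ * _).
under eq_bigr do under eq_bigr do rewrite mulr_sumr.
under eq_bigr do rewrite exchange_big.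
rewrite exchange_big; apply: eq_bigr => S _.
rewrite expr2 mulr_suml; apply: eq_bigr => x _.
rewrite mulr_sumr; apply: eq_bigr => y _; ring.
Qed.

Definition flip i x : cube d := [ffun j => if j == i then ~~ x j else x j].

Lemma flipK i : involutive (flip i).
Proof. by move=> x; apply/ffunP => j; rewrite !ffunE; case: eqP; rewrite ?negbK. Qed.

Lemma chi_flip i S x : chi S (flip i x) = (if i \in S then - chi S x else chi S x) :> R.
Proof.
have E y : chi S y = (if i \in S then sgb (y i) else 1) *
    \prod_(j | j != i) (if j \in S then sgb (y j) else 1).
  by rewrite chiE (bigD1 i).
rewrite !E (eq_bigr (fun j => if j \in S then sgb (x j) else 1)); last first.
  by move=> j /negbTE ji; rewrite ffunE ji.
rewrite ffunE eqxx; case: ifP => _ //.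
by rewrite -mulNr; congr (_ * _); case: (x i) => /=; rewrite sgbT sgbF; ring.
Qed.

Lemma fourier_coef_flip i f S :
  fourier_coef (fun x => f (flip i x)) S =
  if i \in S then - fourier_coef f S else fourier_coef f S.
Proof.
rewrite /fourier_coef -(cube_mean_reindex _ (@flipK i)).
under cube_mean_ext do rewrite flipK chi_flip.
case: ifP => // _; rewrite -mulN1r -cube_meanZ; apply: cube_mean_ext => x; ring.
Qed.

(** The coefficient of [f - f \o flip i] at S is twice that of f if S contains i
and zero otherwise, so each S is counted |S| times.  The sign of the difference
is lost in the square, which makes this form as good as one with [Delta]. *)
Lemma fourier_sobolev_flip f :
  fourier_sobolev f = \sum_i norm2_sq (fun x => f x - f (flip i x)).
Proof.
transitivity (\sum_(i < d) \sum_(S : {set 'I_d}) ((i \in S)%:R * (4 * fourier_coef f S ^+ 2)) : R).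
  rewrite exchange_big /fourier_sobolev mulr_sumr [RHS](bigD1 finset.set0)//=.
  rewrite [X in _ = X + _]big1 ?add0r; last by move=> i _; rewrite inE mul0r.
  apply: eq_bigr => S _; rewrite -mulr_suml mulrCA; congr (_ * _).
  rewrite -sum1_card natr_sum big_mkcond /=.
  by apply: eq_bigr => i _; case: (i \in S).
apply: eq_bigr => i _; rewrite parseval; apply: eq_bigr => S _.
have -> : fourier_coef (fun x => f x - f (flip i x)) S =
   fourier_coef f S - fourier_coef (fun x => f (flip i x)) S.
  rewrite /fourier_coef -[X in _ - X]mul1r -mulNr -cube_meanZ -cube_meanD.
  apply: cube_mean_ext => x; ring.
rewrite fourier_coef_flip; case: (i \in S) => /=; ring.
Qed.

Lemma supp_flipP f i : reflect (forall x, f (flip i x) = f x) (i \notin supp f).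
Proof.
have flipE x : flip i x = set_coord x i (~~ x i).
  by apply/ffunP => j; rewrite !ffunE; case: eqP => // ->.
have setE x : x = set_coord x i (x i).
  by apply/ffunP => j; rewrite !ffunE; case: eqP => // ->.
rewrite inE; apply: (iffP existsPn) => h x.
  have /negPn := h x; rewrite /Delta subr_eq0 => /eqP e.
  by rewrite flipE [in RHS](setE x); case: (x i).
apply/negPn; rewrite /Delta subr_eq0; apply/eqP.
rewrite -[in RHS](h (set_coord x i false)); congr f.
by apply/ffunP => j; rewrite !ffunE; case: eqP => //.
Qed.

Lemma fourier_coef_supp f S : ~~ (S \subset supp f) -> fourier_coef f S = 0.
Proof.
move=> /fintype.subsetPn[i iS /supp_flipP h].
have := fourier_coef_flip i f S; rewrite iS.
have -> : fourier_coef (fun x => f (flip i x)) S = fourier_coef f S.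
  by apply: cube_mean_ext => x; rewrite h.
by move=> e; lra.
Qed.

(** A set S not included in J carries no Fourier mass, and the other sets of the
sum have at least D + 1 elements. *)
Lemma high_degree_tail f J D : supp f \subset J ->
  \sum_(S : {set 'I_d} | ~~ ((S \subset J) && (#|S| <= D)%N)) fourier_coef f S ^+ 2
  <= fourier_sobolev f / (4 * D.+1%:R).
Proof.
move=> fJ; have D0 : 0 < D.+1%:R :> R by rewrite ltr0n.
rewrite ler_pdivlMr; last by rewrite mulr_gt0.
rewrite /fourier_sobolev mulrC -mulrA ler_pM2l// mulr_sumr.
rewrite big_mkcond [leRHS]big_mkcond/=; apply: ler_sum => S _.
case: ifPn; last first.
  by case: ifP => // _; rewrite mulr_ge0 ?sqr_ge0.
rewrite negb_and => /orP[SJ|].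
  rewrite fourier_coef_supp ?expr0n/= ?mulr0; last first.
    by apply: contra SJ => /fintype.subset_trans; apply.
  by case: ifP.
rewrite -ltnNge => DS.
have -> : S != finset.set0 by apply: contraTneq DS => ->; rewrite cards0.
by rewrite ler_wpM2r ?sqr_ge0// ler_nat.
Qed.

Lemma projection_error f J D (ft : {set 'I_d} -> R) : supp f \subset J ->
  norm2_sq (fun x =>
    \sum_(S : {set 'I_d} | (S \subset J) && (#|S| <= D)%N) ft S * chi S x - f x)
  <= \sum_(S : {set 'I_d} | (S \subset J) && (#|S| <= D)%N)
        (ft S - fourier_coef f S) ^+ 2
     + fourier_sobolev f / (4 * D.+1%:R).
Proof.
move=> fJ; rewrite parseval (bigID (fun S : {set 'I_d} => (S \subset J) && (#|S| <= D)%N)) /=.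
have coefE T : fourier_coef (fun x =>
    \sum_(S : {set 'I_d} | (S \subset J) && (#|S| <= D)%N) ft S * chi S x - f x) T =
    (if (T \subset J) && (#|T| <= D)%N then ft T else 0) - fourier_coef f T.
  rewrite /fourier_coef -[X in _ = _ - X]mul1r -mulNr -cube_meanZ.
  transitivity (cube_mean (fun x =>
     \sum_(S : {set 'I_d} | (S \subset J) && (#|S| <= D)%N) ft S * (chi S x * chi T x))
     + cube_mean (fun x => -1 * (f x * chi T x))).
    rewrite -cube_meanD; apply: cube_mean_ext => x.
    rewrite mulrBl mulr_suml; congr (_ + _); last by ring.
    by apply: eq_bigr => S _; ring.
  congr (_ + _); rewrite cube_mean_sum.
  under eq_bigr do rewrite cube_meanZ chi_orth.
  rewrite big_mkcond (bigD1 T)//= eqxx mulr1 big1 ?addr0// => S /negbTE ->.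
  by rewrite mulr0; case: ifP.
apply: lerD.
  by rewrite le_eqVlt; apply/orP; left; apply/eqP/eq_bigr => S SJ; rewrite coefE SJ.
apply: le_trans (high_degree_tail D fJ).
rewrite le_eqVlt; apply/orP; left; apply/eqP/eq_bigr => S /negbTE SJ.
by rewrite coefE SJ sub0r sqrrN.
Qed.

End Fourier.

(** * Expectations over design and noise *)

Section SampleExpectation.
Context {R : realType}.
Local Open Scope ereal_scope.

(** The integral of a nonnegative function is the supremum of the integrals of the
simple functions below it. *)
Lemma nonneg_integral_le disp (T : measurableType disp)
    (mu : {measure set T -> \bar R}) (f g : T -> \bar R) :
  (forall x, 0 <= f x) -> (forall x, f x <= g x) ->
  \int[mu]_x f x <= \int[mu]_x g x.
Proof.
move=> f0 fg; have g0 x : 0 <= g x by exact: le_trans (fg x).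
rewrite !ge0_integralTE//; apply: ereal_sup_le.
by move=> _ [h hf <-]; exists h => // x; apply: le_trans (fg x); exact: hf.
Qed.

Lemma tuple_sum_cons (V : nmodType) (T : finType) n (G : n.+1.-tuple T -> V) :
  (\sum_X G X = \sum_x \sum_(X : n.-tuple T) G [tuple of x :: X])%R.
Proof.
rewrite pair_bigA (reindex (fun p : T * n.-tuple T => [tuple of p.1 :: p.2]))//.
exists (fun X => (thead X, [tuple of behead X])) => [[x X] _|X _] /=.
  by congr pair; apply: val_inj.
by rewrite [RHS]tuple_eta.
Qed.

(** Same shape as [risk], to which it is convertible when F is the squared error
of an estimator. *)
Definition EX (P : probability R R) n d
    (F : n.-tuple (cube d) -> n.-tuple R -> R) : \bar R :=
  ((2 ^+ (d * n))^-1)%:E * \sum_X \int[iid_law P n]_e (F X e)%:E.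

Context (P : probability R R) (d : nat).
Implicit Types n k m : nat.

Let c0 n : 0 <= (((2 ^+ (d * n))^-1 : R)%:E).
Proof. by rewrite lee_fin invr_ge0 exprn_ge0. Qed.

Lemma EX_ge0 n (F : n.-tuple (cube d) -> n.-tuple R -> R) :
  (forall X e, (0 <= F X e)%R) -> 0 <= EX P F.
Proof.
by move=> F0; rewrite mule_ge0// sume_ge0// => X _; apply: integral_ge0 => e _; rewrite lee_fin.
Qed.

Lemma EX_le n (F G : n.-tuple (cube d) -> n.-tuple R -> R) :
  (forall X e, (0 <= F X e)%R) -> (forall X e, (F X e <= G X e)%R) ->
  EX P F <= EX P G.
Proof.
move=> F0 FG; apply: lee_wpmul2l => //; apply: lee_sum => X _.
by apply: nonneg_integral_le => e; rewrite lee_fin.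
Qed.

Lemma EX_cst n (a : R) : EX P (fun (_ : n.-tuple (cube d)) _ => a) = a%:E.
Proof.
rewrite /EX; under eq_bigr do rewrite integral_cst//= probability_setT mule1.
rewrite sumEFin -EFinM sumr_const card_tuple card_ffun card_bool card_ord.
rewrite -[(a *+ _)%R]mulr_natl -expnM natrX mulrA mulVf ?mul1r//.
Qed.

Lemma EX_Z n (a : R) (F : n.-tuple (cube d) -> n.-tuple R -> R) : (0 <= a)%R ->
  (forall X e, (0 <= F X e)%R) -> (forall X, measurable_fun setT (F X)) ->
  EX P (fun X e => (a * F X e)%R) = a%:E * EX P F.
Proof.
move=> a0 F0 mF; rewrite /EX muleCA; congr (_ * _).
rewrite ge0_sume_distrr; last by move=> X _; apply: integral_ge0 => e _; rewrite lee_fin.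
apply: eq_bigr => X _; under eq_integral do rewrite EFinM.
by rewrite ge0_integralZl_EFin//; [move=> e _; rewrite lee_fin|exact/measurable_EFinP].
Qed.

Lemma EX_D n (F G : n.-tuple (cube d) -> n.-tuple R -> R) :
  (forall X e, (0 <= F X e)%R) -> (forall X, measurable_fun setT (F X)) ->
  (forall X e, (0 <= G X e)%R) -> (forall X, measurable_fun setT (G X)) ->
  EX P (fun X e => (F X e + G X e)%R) = EX P F + EX P G.
Proof.
move=> F0 mF G0 mG; rewrite /EX -ge0_muleDr; last 2 first.
- by rewrite sume_ge0// => X _; apply: integral_ge0 => e _; rewrite lee_fin.
- by rewrite sume_ge0// => X _; apply: integral_ge0 => e _; rewrite lee_fin.
rewrite -big_split; congr (_ * _); apply: eq_bigr => X _.
under eq_integral do rewrite EFinD.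
by rewrite ge0_integralD//; [move=> e _; rewrite lee_fin|exact/measurable_EFinP|
  move=> e _; rewrite lee_fin|exact/measurable_EFinP].
Qed.

Lemma EX_sum n (I : Type) (r : seq I) (Q : pred I)
    (F : I -> n.-tuple (cube d) -> n.-tuple R -> R) :
  (forall i X e, (0 <= F i X e)%R) -> (forall i X, measurable_fun setT (F i X)) ->
  EX P (fun X e => (\sum_(i <- r | Q i) F i X e)%R) = \sum_(i <- r | Q i) EX P (F i).
Proof.
move=> F0 mF.
have -> : (fun X e => \sum_(i <- r | Q i) F i X e)%R =
          (fun X e => \sum_(i <- [seq j <- r | Q j]) F i X e)%R.
  by apply/funext => X; apply/funext => e; rewrite big_filter.
rewrite -[RHS]big_filter; elim: [seq j <- r | Q j] => [|i s IH].
  rewrite big_nil -[RHS](EX_cst n 0); congr EX.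
  by apply/funext => X; apply/funext => e; rewrite big_nil.
rewrite big_cons -IH -EX_D//.
- by congr EX; apply/funext => X; apply/funext => e; rewrite big_cons.
- by move=> X e; apply: sumr_ge0.
- by move=> X; apply: measurable_sum.
Qed.

Lemma integral_iid_S n (G : n.+1.-tuple R -> R) :
  (forall e, (0 <= G e)%R) -> measurable_fun setT G ->
  measurable_fun setT (fun t => \int[iid_law P n]_e (G [tuple of t :: e])%:E) /\
  \int[iid_law P n.+1]_e (G e)%:E =
  \int[P]_t \int[iid_law P n]_e (G [tuple of t :: e])%:E.
Proof.
move=> G0 mG; pose H (z : R * n.-tuple R) := (G (cons_pair z))%:E.
have mH : measurable_fun setT H.
  by apply/measurable_EFinP; apply: measurableT_comp => //; exact: measurable_cons_pair.
have H0 z : 0 <= H z by rewrite lee_fin.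
split; first exact: (measurable_fun_fubini_tonelli_F (m2 := iid_law P n) H mH H0).
rewrite ge0_integral_distribution; [|exact/measurable_EFinP|by move=> y; rewrite lee_fin].
by rewrite -[LHS]/(\int[P \x iid_law P n]_z H z) fubini_tonelli1.
Qed.

(** The observations are independent, so the first one can be averaged out last;
the induction steps below all go through this identity. *)
Lemma EX_S n (F : n.+1.-tuple (cube d) -> n.+1.-tuple R -> R) :
  (forall X e, (0 <= F X e)%R) -> (forall X, measurable_fun setT (F X)) ->
  EX P F = ((2 ^+ d)^-1)%:E * \sum_(x : cube d) \int[P]_t
    EX P (fun (X : n.-tuple (cube d)) e => F [tuple of x :: X] [tuple of t :: e]).
Proof.
move=> F0 mF; rewrite /EX mulnS exprD invfM EFinM -muleA; congr (_ * _).
rewrite tuple_sum_cons ge0_sume_distrr; last first.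
  by move=> x _; rewrite sume_ge0// => X _; apply: integral_ge0 => e _; rewrite lee_fin.
apply: eq_bigr => x _.
have h (X : n.-tuple (cube d)) := integral_iid_S (F0 [tuple of x :: X]) (mF _).
rewrite ge0_integralZl_EFin//; last 2 first.
- by move=> t _; rewrite sume_ge0// => X _; apply: integral_ge0 => e _; rewrite lee_fin.
- by apply: emeasurable_sum => X; case: (h X).
congr (_ * _); rewrite ge0_integral_sum//; last 2 first.
- by move=> X; case: (h X).
- by move=> X t _; apply: integral_ge0 => e _; rewrite lee_fin.
by apply: eq_bigr => X _; case: (h X).
Qed.

Lemma EX_S_le n (F : n.+1.-tuple (cube d) -> n.+1.-tuple R -> R)
    (h : cube d -> R -> \bar R) (c : \bar R) :
  (forall X e, (0 <= F X e)%R) -> (forall X, measurable_fun setT (F X)) ->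
  (forall x t, EX P (fun (X : n.-tuple (cube d)) e =>
     F [tuple of x :: X] [tuple of t :: e]) <= h x t) ->
  ((2 ^+ d)^-1)%:E * \sum_(x : cube d) \int[P]_t h x t <= c ->
  EX P F <= c.
Proof.
move=> F0 mF Fh; apply: le_trans; rewrite EX_S//.
apply: lee_wpmul2l; first by rewrite lee_fin invr_ge0 exprn_ge0.
apply: lee_sum => x _; apply: nonneg_integral_le => t //.
exact: EX_ge0.
Qed.

Lemma measurable_cons_section n (F : n.+1.-tuple R -> R) t :
  measurable_fun setT F -> measurable_fun setT (fun e : n.-tuple R => F [tuple of t :: e]).
Proof.
by move=> mF; apply: (measurableT_comp mF); exact: measurable_cons.
Qed.

(** An inequality, because the noise factors are known through upper bounds on
exponential moments only. *)
Lemma EX_prod_le n (phi : 'I_n -> cube d -> R -> R) (c : 'I_n -> R) :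
  (forall j x t, (0 <= phi j x t)%R) -> (forall j x, measurable_fun setT (phi j x)) ->
  (forall j, (0 <= c j)%R) ->
  (forall j, ((2 ^+ d)^-1)%:E * \sum_(x : cube d) \int[P]_t (phi j x t)%:E <= (c j)%:E) ->
  EX P (fun X e => \prod_(j < n) phi j (tnth X j) (tnth e j))%R <= (\prod_(j < n) c j)%:E.
Proof.
elim: n => [|n IH] in phi c *; move=> phi0 mphi c_ge0 phic.
  rewrite big_ord0 -(EX_cst 0 1); apply: EX_le => X e; last by rewrite big_ord0.
  by rewrite prodr_ge0.
have phi'0 (X : n.-tuple (cube d)) (e : n.-tuple R) :
  (0 <= \prod_(j < n) phi (lift ord0 j) (tnth X j) (tnth e j))%R by rewrite prodr_ge0.
have mphi' m (f : 'I_m -> cube d -> R -> R) (X : m.-tuple (cube d)) :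
   (forall j x, measurable_fun setT (f j x)) ->
   measurable_fun setT (fun e : m.-tuple R => \prod_(j < m) f j (tnth X j) (tnth e j))%R.
  move=> mf; apply: measurable_prod => j _.
  by apply: measurableT_comp; [exact: mf|exact: measurable_tnth].
pose C := (\prod_(j < n) c (lift ord0 j))%R.
have C0 : (0 <= C)%R by rewrite prodr_ge0.
apply: (@EX_S_le _ _ (fun x t => C%:E * (phi ord0 x t)%:E)).
- by move=> X e; rewrite prodr_ge0.
- by move=> X; exact: mphi'.
- move=> x t; rewrite muleC.
  have -> : (fun (X : n.-tuple (cube d)) (e : n.-tuple R) =>
      \prod_(j < n.+1) phi j (tnth [tuple of x :: X] j) (tnth [tuple of t :: e] j))%R =
     (fun X e => phi ord0 x t * \prod_(j < n) phi (lift ord0 j) (tnth X j) (tnth e j))%R.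
    apply/funext => X; apply/funext => e; rewrite big_ord_recl; congr (_ * _)%R.
    by apply: eq_bigr => j _; rewrite !tnthS.
  rewrite EX_Z//; last by move=> X; exact: (mphi' _ (fun j => phi (lift ord0 j))).
  by apply: lee_wpmul2l; [rewrite lee_fin|
    apply: (IH (fun j => phi (lift ord0 j)) (fun j => c (lift ord0 j)))].
- have -> : \sum_(x : cube d) \int[P]_t (C%:E * (phi ord0 x t)%:E) =
      \sum_(x : cube d) (C%:E * \int[P]_t (phi ord0 x t)%:E).
    apply: eq_bigr => x _; rewrite ge0_integralZl_EFin//.
      by move=> t _; rewrite lee_fin.
    exact/measurable_EFinP.
  rewrite -ge0_sume_distrr; last first.
    by move=> x _; apply: integral_ge0 => t _; rewrite lee_fin.
  rewrite muleCA big_ord_recl mulrC EFinM.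
  by apply: lee_wpmul2l; rewrite ?lee_fin.
Qed.

(** A bound that holds for the last m observations whatever the first k are is
inherited by the whole sample. *)
Lemma EX_cat_le k m (F : (k + m).-tuple (cube d) -> (k + m).-tuple R -> R) (c : R) :
  (forall X e, (0 <= F X e)%R) -> (forall X, measurable_fun setT (F X)) ->
  (forall (X1 : k.-tuple (cube d)) (e1 : k.-tuple R),
    EX P (fun (X2 : m.-tuple (cube d)) e2 =>
      F [tuple of X1 ++ X2] [tuple of e1 ++ e2]) <= c%:E) ->
  EX P F <= c%:E.
Proof.
elim: k => [|k IH] in F *; move=> F0 mF H.
  have := H [tuple] [tuple]; congr (_ <= _); congr EX.
  by apply/funext => X; apply/funext => e; congr F; apply: val_inj.
apply: (@EX_S_le _ _ (fun _ _ => c%:E)) => //.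
  move=> x t; apply: IH => // [X|X1 e1].
    exact: (@measurable_cons_section (k + m) (F [tuple of x :: X]) t (mF _)).
  have := H [tuple of x :: X1] [tuple of t :: e1]; congr (_ <= _); congr EX.
  by apply/funext => X; apply/funext => e; congr F; apply: val_inj.
under eq_bigr do rewrite integral_cst//= probability_setT mule1.
rewrite sumEFin -EFinM sumr_const card_ffun card_bool card_ord.
rewrite -[(c *+ _)%R]mulr_natl natrX mulrA mulVf ?mul1r//.
Qed.

End SampleExpectation.

Lemma measurable_sum_cond {R : realType} disp (T : measurableType disp) (D : set T)
    (I : Type) (r : seq I) (Q : pred I) (h : I -> T -> R) :
  (forall i, measurable_fun D (h i)) ->
  measurable_fun D (fun x => \sum_(i <- r | Q i) h i x).
Proof.
move=> mh; rewrite (_ : (fun _ => _) = (fun x => \sum_(i <- [seq i <- r | Q i]) h i x)).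
  exact: measurable_sum.
by apply/funext => x; rewrite big_filter.
Qed.

(** * Exponential moments *)

Section MgfBounds.
Context {R : realType}.

(** From [expR v <= (1 - v)^-1], valid for all v < 1. *)
Lemma expR_quad (v : R) : v <= 2^-1 -> expR v <= 1 + v + 2 * v ^+ 2.
Proof.
move=> v2; have h := expR_ge1Dx (- v).
have h1 : 0 < 1 - v by lra.
rewrite -[expR v]invrK -expRN; apply: (@le_trans _ _ (1 - v)^-1).
  by rewrite lef_pV2// posrE// expR_gt0.
rewrite -[(1 - v)^-1]mul1r ler_pdivrMr//.
have -> : (1 + v + 2 * v ^+ 2) * (1 - v) = 1 + v ^+ 2 * (1 - 2 * v) by ring.
by rewrite lerDl mulr_ge0 ?sqr_ge0//; lra.
Qed.

(** Converts bounds on the exponential moments of v and -v into one on its second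
moment. *)
Lemma sqr_le_expR_sym (v : R) : v ^+ 2 <= 4 * (expR v + expR (- v)).
Proof.
have pos (w : R) : 0 <= w -> w ^+ 2 <= 4 * expR w.
  move=> w0; have -> : w = w / 2 + w / 2 by field.
  rewrite expRD; have := expR_ge1Dx (w / 2); have := expR_ge0 (w / 2).
  by set a := expR _; nra.
have := expR_ge0 v; have := expR_ge0 (- v).
have [/pos|/ltW v0] := leP 0 v; first by lra.
have /pos : 0 <= - v by lra.
by rewrite sqrrN; lra.
Qed.

Lemma norm_le1_sqr (u : R) : `|u| <= 1 -> 0 <= u ^+ 2 <= 1.
Proof. by rewrite ler_norml => /andP[u1 u2]; rewrite sqr_ge0; nra. Qed.

Context (sigma2 : R).
Hypothesis sigma2_gt0 : 0 < sigma2.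

(** The exponent lam at which excess losses are exponentiated.  It is small enough
that the noise term 2 sigma2 lam^2 g^2 is at most half of lam g^2, and that
lam <= 1/4 keeps the exponents within the range of [expR_quad]. *)
Definition inv_temperature : R := (4 * (1 + sigma2))^-1.
Let lam := inv_temperature.

Lemma inv_temperature_gt0 : 0 < lam.
Proof. by have s0 := sigma2_gt0; rewrite invr_gt0; lra. Qed.

Lemma inv_temperature_bound : [/\ 0 < lam, lam <= 4^-1 & sigma2 * lam <= 4^-1].
Proof.
have s0 := sigma2_gt0; have h : lam * (4 * (1 + sigma2)) = 1 by
  rewrite mulVf//; apply: lt0r_neq0; lra.
have l0 := inv_temperature_gt0; have ls : 0 < sigma2 * lam by rewrite mulr_gt0.
have {}h : 4 * lam + 4 * (sigma2 * lam) = 1 by rewrite -[RHS]h; ring.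
by split => //; lra.
Qed.

(** One observation contributes g(X)^2 - 2 e g(X) to the excess loss of a
candidate with error g.  After the noise is integrated out, the exponent is at
most -lam/2 g^2, and E exp (-lam/2 g^2) <= 1 - lam/4 |g|^2: the excess loss
is unlikely to be less than a quarter of its mean. *)
Lemma excess_below_mgf d (g : cube d -> R) : (forall x, `|g x| <= 1) ->
  cube_mean (fun x => expR ((- lam * g x ^+ 2 + lam / 4 * norm2_sq g)
                        + sigma2 * (2 * lam * g x) ^+ 2 / 2)) <= 1.
Proof.
move=> g1; have [l0 l4 sl] := inv_temperature_bound.
rewrite (@cube_mean_ext _ _ _ (fun x => expR (lam / 4 * norm2_sq g) *
  expR (- (lam * (1 - 2 * (sigma2 * lam))) * g x ^+ 2))); last first.
  by move=> x; rewrite -expRD; congr expR; field.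
rewrite cube_meanZ -ler_pdivlMl ?expR_gt0// mulr1 -expRN.
apply: le_trans (expR_ge1Dx _).
apply: (@le_trans _ _ (cube_mean (fun x => 1 + - (lam / 4) * g x ^+ 2))); last first.
  by rewrite cube_meanD cube_mean_cst cube_meanZ /norm2_sq mulNr.
apply: cube_mean_le => x.
have /andP[] := norm_le1_sqr (g1 x); set u := g x ^+ 2 => u0 u1.
have lu : 0 <= lam * u by rewrite mulr_ge0// ltW.
have lu4 : lam * u <= 4^-1 by nra.
have slu : 0 <= (lam * u) * (4^-1 - sigma2 * lam) by rewrite mulr_ge0// subr_ge0.
apply: (@le_trans _ _ (expR (- (lam / 2 * u)))).
  by rewrite ler_expR -/u; lra.
apply: le_trans (expR_quad _) _; first by lra.
have : 0 <= (lam * u) * (4^-1 - lam * u) by rewrite mulr_ge0// subr_ge0.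
lra.
Qed.

(** The opposite deviation, needed for the oracle set only: the exponent is now
at most 3/2 lam g^2, whose exponential has mean at most 1 + 3 lam |g|^2. *)
Lemma excess_above_mgf d (g : cube d -> R) : (forall x, `|g x| <= 1) ->
  cube_mean (fun x => expR ((lam * g x ^+ 2 + - (3 * lam) * norm2_sq g)
                        + sigma2 * (- (2 * lam) * g x) ^+ 2 / 2)) <= 1.
Proof.
move=> g1; have [l0 l4 sl] := inv_temperature_bound.
rewrite (@cube_mean_ext _ _ _ (fun x => expR (- (3 * lam * norm2_sq g)) *
  expR ((lam * (1 + 2 * (sigma2 * lam))) * g x ^+ 2))); last first.
  by move=> x; rewrite -expRD; congr expR; field.
rewrite cube_meanZ expRN -ler_pdivlMl ?invr_gt0 ?expR_gt0// invrK mulr1.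
apply: le_trans (expR_ge1Dx _).
apply: (@le_trans _ _ (cube_mean (fun x => 1 + (3 * lam) * g x ^+ 2))); last first.
  by rewrite cube_meanD cube_mean_cst cube_meanZ.
apply: cube_mean_le => x.
have /andP[] := norm_le1_sqr (g1 x); set u := g x ^+ 2 => u0 u1.
have lu : 0 <= lam * u by rewrite mulr_ge0// ltW.
have lu4 : lam * u <= 4^-1 by nra.
have slu : 0 <= (lam * u) * (4^-1 - sigma2 * lam) by rewrite mulr_ge0// subr_ge0.
apply: (@le_trans _ _ (expR (3 / 2 * (lam * u)))).
  by rewrite ler_expR -/u; lra.
apply: le_trans (expR_quad _) _; first by lra.
have : 0 <= (lam * u) * (4^-1 - lam * u) by rewrite mulr_ge0// subr_ge0.
lra.
Qed.

Lemma centered_mgf d (h : cube d -> R) (b : cube d -> R) (c : R) :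
  (forall x, `|h x| <= 2) -> cube_mean h = 0 -> (forall x, b x ^+ 2 = 1) ->
  `|c| <= 4^-1 ->
  cube_mean (fun x => expR (c * h x + sigma2 * (c * b x) ^+ 2 / 2)) <=
  expR ((8 + sigma2 / 2) * c ^+ 2).
Proof.
move=> h2 hmean b1 c4.
have c4' : - 4^-1 <= c <= 4^-1 by rewrite -ler_norml.
rewrite (@cube_mean_ext _ _ _ (fun x => expR (sigma2 / 2 * c ^+ 2) * expR (c * h x)));
  last first.
  by move=> x; rewrite -expRD exprMn b1; congr expR; field.
rewrite cube_meanZ mulrDl [8 * _ + _]addrC expRD ler_pM2l ?expR_gt0//.
apply: le_trans (expR_ge1Dx _).
apply: (@le_trans _ _ (cube_mean (fun x => (1 + 8 * c ^+ 2) + c * h x))); last first.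
  by rewrite cube_meanD cube_mean_cst cube_meanZ hmean mulr0 addr0.
apply: cube_mean_le => x.
have hx : - 2 <= h x <= 2 by rewrite -ler_norml.
apply: le_trans (expR_quad _) _; first by nra.
suff : h x ^+ 2 <= 4 by have := sqr_ge0 c; rewrite exprMn; nra.
nra.
Qed.

End MgfBounds.

Section NoiseMgf.
Context {R : realType}.
Context (sigma2 : R) (P : probability R R).
Hypothesis noiseP : noise_class sigma2 P.

Lemma noise_mgf (t : R) :
  (\int[P]_e (expR (t * e))%:E <= (expR (sigma2 * t ^+ 2 / 2))%:E)%E.
Proof.
case: noiseP => _ _ /(_ t); rewrite /mmt_gen_fun unlock.
apply: le_trans; rewrite le_eqVlt; apply/orP; left; apply/eqP.
by apply: eq_integral => e _; rewrite /= [e * t]mulrC.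
Qed.

Lemma one_observation_mgf d (a b : cube d -> R) :
  (((2 ^+ d)^-1)%:E * \sum_(x : cube d) \int[P]_t (expR (a x + b x * t))%:E
   <= (cube_mean (fun x => expR (a x + sigma2 * b x ^+ 2 / 2)))%:E)%E.
Proof.
rewrite /cube_mean EFinM -sumEFin; apply: lee_wpmul2l.
  by rewrite lee_fin invr_ge0 exprn_ge0.
apply: lee_sum => x _.
under eq_integral do rewrite expRD EFinM.
rewrite ge0_integralZl_EFin ?expR_ge0//; last first.
  by apply/measurable_EFinP; apply: measurableT_comp => //.
rewrite expRD EFinM; apply: lee_wpmul2l; first by rewrite lee_fin expR_ge0.
exact: noise_mgf.
Qed.

(** Given the first k observations, G is the fixed function G', and the
exponential is a product over the last m observations, each of whose factors
has mean at most 1. *)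
Lemma holdout_mgf k m d (al be ga : R)
    (G : (k + m).-tuple (cube d) -> (k + m).-tuple R -> cube d -> R)
    (G' : k.-tuple (cube d) -> k.-tuple R -> cube d -> R) :
  (forall X x, measurable_fun setT (fun e => G X e x)) ->
  (forall (X1 : k.-tuple (cube d)) (X2 : m.-tuple (cube d))
     (e1 : k.-tuple R) (e2 : m.-tuple R),
     G [tuple of X1 ++ X2] [tuple of e1 ++ e2] = G' X1 e1) ->
  (forall X1 e1,
    cube_mean (fun x => expR ((al * G' X1 e1 x ^+ 2 + ga * norm2_sq (G' X1 e1))
                        + sigma2 * (be * G' X1 e1 x) ^+ 2 / 2)) <= 1) ->
  (EX P (fun X e => expR (
     \sum_(j < k + m | (k <= j)%N)
        (al * G X e (tnth X j) ^+ 2 + be * G X e (tnth X j) * tnth e j)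
     + m%:R * (ga * norm2_sq (G X e)))) <= 1%:E)%E.
Proof.
move=> mG GG' Hone; apply: EX_cat_le => [X e|X|X1 e1]; first exact: expR_ge0.
  apply: measurableT_comp => //; apply: measurable_funD.
    apply: measurable_sum_cond => j; apply: measurable_funD.
      apply: measurable_funM; first exact: measurable_cst.
      by apply: measurable_funX; exact: mG.
    apply: measurable_funM; last exact: measurable_tnth.
    by apply: measurable_funM; [exact: measurable_cst|exact: mG].
  apply: measurable_funM; first exact: measurable_cst.
  apply: measurable_funM; first exact: measurable_cst.
  rewrite /norm2_sq /cube_mean; apply: measurable_funM; first exact: measurable_cst.
  by apply: measurable_sum => x; apply: measurable_funX; exact: mG.
set g := G' X1 e1.
apply: (@le_trans _ _ (EX P (fun (X2 : m.-tuple (cube d)) e2 =>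
   \prod_(j < m) expR ((al * g (tnth X2 j) ^+ 2 + ga * norm2_sq g)
      + be * g (tnth X2 j) * tnth e2 j)))).
  apply: EX_le => X2 e2; first exact: expR_ge0.
  rewrite GG' -/g -expR_sum ler_expR le_eqVlt; apply/orP; left; apply/eqP.
  rewrite big_split_ord /= big1 ?add0r; last by move=> i; rewrite leqNgt ltn_ord.
  rewrite (eq_bigl predT) => [|i]; last by rewrite leq_addr.
  rewrite -[m in m%:R]card_ord mulr_natl -sumr_const -big_split /=.
  apply: eq_bigr => j _; rewrite !(tnth_rshift); ring.
apply: (@le_trans _ _ (\prod_(j < m) 1)%:E); last by rewrite big1.
apply: (EX_prod_le (phi := fun _ x t => expR ((al * g x ^+ 2 + ga * norm2_sq g)
      + be * g x * t)) (c := fun=> 1)) => //.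
- move=> j x; apply: measurableT_comp => //; apply: measurable_funD => //.
- move=> j; apply: le_trans (one_observation_mgf _ _) _.
  rewrite lee_fin; exact: Hone.
Qed.

End NoiseMgf.

(** * Error of the empirical Fourier coefficients *)

Section EstimatorRegularity.
Context {R : realType} {n d : nat}.
Implicit Types (X : n.-tuple (cube d)) (J S : {set 'I_d}) (f : cube d -> R).

Lemma measurable_responses f X :
  measurable_fun setT (fun e : n.-tuple R => responses f X e).
Proof.
apply/measurable_fun_tnthP => j.
rewrite (_ : _ \o _ = fun e : n.-tuple R => f (tnth X j) + tnth e j); last first.
  by apply/funext => e /=; rewrite tnth_mktuple.
by apply: measurable_funD => //; exact: measurable_tnth.
Qed.

Lemma measurable_empirical_coef X S :
  measurable_fun setT (fun Y : n.-tuple R => empirical_coef X Y S).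
Proof.
apply: measurable_funM => //; apply: measurable_sum_cond => j.
by apply: measurable_funM => //; exact: measurable_tnth.
Qed.

Lemma measurable_proj_estimator D J X (x : cube d) :
  measurable_fun setT (fun Y : n.-tuple R => proj_estimator D J X Y x).
Proof.
apply: measurable_maxr => //; apply: measurable_minr => //.
apply: measurable_sum_cond => S; apply: measurable_funM => //.
exact: measurable_empirical_coef.
Qed.

Lemma proj_estimator_bounds D J X (Y : n.-tuple R) x :
  0 <= proj_estimator D J X Y x <= 1.
Proof.
rewrite /proj_estimator /clip01 le_max lexx /= ge_max ler01 /=.
by rewrite ge_min lexx orbT.
Qed.

Lemma clip01_contract (t u : R) : 0 <= u <= 1 -> (clip01 t - u) ^+ 2 <= (t - u) ^+ 2.
Proof.
move=> /andP[u0 u1]; rewrite /clip01; case: (leP t 1) => t1; last first.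
  rewrite max_r//; have : 0 <= (t - 1) * (1 - u) by rewrite mulr_ge0//; lra.
  by have := sqr_ge0 (t - 1); nra.
case: (leP 0 t) => t0 //.
have : 0 <= - t * u by rewrite mulr_ge0//; lra.
by have := sqr_ge0 t; nra.
Qed.

(** Clipping to [0, 1] brings every value closer to that of f. *)
Lemma proj_estimator_error f D J X (Y : n.-tuple R) :
  (forall x, 0 <= f x <= 1) -> supp f \subset J ->
  norm2_sq (fun x => proj_estimator D J X Y x - f x) <=
  \sum_(S : {set 'I_d} | (S \subset J) && (#|S| <= D)%N)
     (empirical_coef X Y S - fourier_coef f S) ^+ 2
  + fourier_sobolev f / (4 * D.+1%:R).
Proof.
move=> f01 fJ; apply: le_trans (projection_error D _ fJ).
by apply: cube_mean_le => x; exact: clip01_contract.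
Qed.

End EstimatorRegularity.

Section CoefficientError.
Context {R : realType} {sigma2 : R} {P : probability R R} {k m d : nat}.
Hypotheses (noiseP : noise_class sigma2 P) (sigma2_gt0 : 0 < sigma2).
Hypotheses (half : (k + m)./2 = k) (k16 : (16 <= k)%N).
Context (f : cube d -> R) (S : {set 'I_d}).
Hypothesis f01 : forall x, 0 <= f x <= 1.

Let dev (c : R) (X : (k + m).-tuple (cube d)) (e : (k + m).-tuple R) :=
  \sum_(j < k + m | (j < k)%N) (c * (f (tnth X j) * chi S (tnth X j) - fourier_coef f S)
     + c * chi S (tnth X j) * tnth e j).

Lemma chi_norm x : `|chi S x : R| = 1.
Proof. by apply/eqP; rewrite -sqr_norm_eq1 expr2 chi_sq. Qed.

(** The observations of the second half get the factor 1, so that the product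
over the whole sample can be used. *)
Lemma deviation_mgf (c : R) : `|c| <= 4^-1 ->
  (EX P (fun X e => expR (dev c X e)) <= (expR ((8 + sigma2 / 2) * c ^+ 2 *+ k))%:E)%E.
Proof.
move=> c4.
have fchi x : - 1 <= f x * chi S x <= 1.
  rewrite -ler_norml normrM chi_norm mulr1 ger0_norm; by case/andP: (f01 x).
have coefb : - 1 <= fourier_coef f S <= 1.
  exact: cube_mean_bounds.
pose phi (j : 'I_(k + m)) (x : cube d) (t : R) := if (j < k)%N then
  expR (c * (f x * chi S x - fourier_coef f S) + c * chi S x * t) else 1.
pose cc (j : 'I_(k + m)) := if (j < k)%N then expR ((8 + sigma2 / 2) * c ^+ 2) else 1.
rewrite (_ : expR _ = \prod_(j < k + m) cc j); last first.
  rewrite big_split_ord /= [X in _ = _ * X]big1 ?mulr1; last first.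
    by move=> j _; rewrite /cc /= ltnNge leq_addr.
  rewrite (eq_bigr (fun=> expR ((8 + sigma2 / 2) * c ^+ 2))); last first.
    by move=> j _; rewrite /cc /= ltn_ord.
  by rewrite prodr_const card_ord -mulr_natl expRM_natl.
apply: (@le_trans _ _ (EX P (fun X e => \prod_(j < k + m) phi j (tnth X j) (tnth e j)))).
  apply: EX_le => X e; first exact: expR_ge0.
  rewrite /dev big_mkcond expR_sum le_eqVlt; apply/orP; left; apply/eqP.
  by apply: eq_bigr => j _; rewrite /phi /=; case: ifP; rewrite ?expR0.
apply: (EX_prod_le (phi := phi) (c := cc)).
- by move=> j x t; rewrite /phi /=; case: ifP => _ //; exact: expR_ge0.
- move=> j x; rewrite /phi; case: (j < k)%N => //.
  by apply: measurableT_comp => //; apply: measurable_funD.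
- by move=> j; rewrite /cc /=; case: ifP => _ //; exact: expR_ge0.
move=> j; rewrite /phi /cc; case: (j < k)%N; last first.
  under eq_bigr do rewrite integral_cst//= probability_setT mule1.
  by rewrite sumEFin -EFinM lee_fin -[leRHS](@cube_mean_cst R d).
apply: le_trans (one_observation_mgf noiseP _ _) _.
rewrite lee_fin.
apply: (@centered_mgf R sigma2 d (fun x => f x * chi S x - fourier_coef f S) (chi S) c) => //.
- by move=> x; rewrite ler_norml; have := fchi x; lra.
- rewrite (_ : fourier_coef f S = fourier_coef f S * 1) ?mulr1//.
  by rewrite (@cube_meanD R d _ (fun=> - fourier_coef f S)) cube_mean_cst subrr.
- by move=> x; rewrite expr2 chi_sq.
Qed.

(** Taking c = k^(-1/2) in [deviation_mgf] keeps the exponential moments of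
(sqrt k) times the error bounded by a constant; k >= 16 makes c <= 1/4. *)
Lemma empirical_coef_error :
  (EX P (fun (X : (k + m).-tuple (cube d)) e =>
     ((empirical_coef X (responses f X e) S - fourier_coef f S) ^+ 2)%R)
   <= (8 * expR (8 + sigma2 / 2) / k%:R)%R%:E)%E.
Proof.
have k0 : 0 < k%:R :> R by rewrite ltr0n; apply: leq_trans k16.
pose c : R := (Num.sqrt k%:R)^-1.
have csq : c ^+ 2 = k%:R^-1 by rewrite exprVn sqr_sqrtr// ltW.
have c0 : 0 <= c by rewrite invr_ge0 sqrtr_ge0.
have c4 : `|c| <= 4^-1.
  have c16 : c ^+ 2 <= 16^-1 by rewrite csq lef_pV2 ?posrE// ler_nat.
  by rewrite ger0_norm//; nra.
have devE X e : (empirical_coef X (responses f X e) S - fourier_coef f S) ^+ 2 =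
    k%:R^-1 * dev c X e ^+ 2.
  rewrite -csq -exprMn; congr (_ ^+ 2); rewrite /empirical_coef half.
  have -> : dev c X e = c * (\sum_(j < k + m | (j < k)%N)
      tnth (responses f X e) j * chi S (tnth X j) - k%:R * fourier_coef f S).
    have -> : k%:R * fourier_coef f S = \sum_(j < k + m | (j < k)%N) fourier_coef f S.
      rewrite big_split_ord /= [X in _ = _ + X]big1 ?addr0; last first.
        by move=> j; rewrite ltnNge leq_addr.
      rewrite (eq_bigl predT) => [|j]; last by rewrite /= ltn_ord.
      by rewrite sumr_const card_ord mulr_natl.
    rewrite -sumrB mulr_sumr; apply: eq_bigr => j _.
    by rewrite tnth_mktuple; ring.
  by rewrite mulrA -expr2 csq mulrBr mulrA mulVf ?mul1r// gt_eqF.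
have devN X e : expR (- dev c X e) = expR (dev (- c) X e).
  by congr expR; rewrite /dev -sumrN; apply: eq_bigr => j _; ring.
have mdev c' X : measurable_fun setT (fun e => expR (dev c' X e)).
  apply: measurableT_comp => //; apply: measurable_sum_cond => j.
  apply: measurable_funD => //; apply: measurable_funM => //; exact: measurable_tnth.
apply: (@le_trans _ _ (EX P (fun (X : (k + m).-tuple (cube d)) e =>
    (4 / k%:R) * (expR (dev c X e) + expR (dev (- c) X e))))).
  apply: EX_le => X e; first exact: sqr_ge0.
  rewrite devE -devN mulrAC [leRHS]mulrC ler_pM2l ?invr_gt0//.
  exact: sqr_le_expR_sym.
have ge0 c' (X : (k + m).-tuple (cube d)) e : 0 <= expR (dev c' X e) by exact: expR_ge0.
rewrite EX_Z; last 3 first.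
- by rewrite divr_ge0// ltW.
- by move=> X e; rewrite addr_ge0.
- by move=> X; apply: measurable_funD; exact: mdev.
rewrite EX_D//.
have -> : 8 * expR (8 + sigma2 / 2) / k%:R =
   (4 / k%:R) * (expR (8 + sigma2 / 2) + expR (8 + sigma2 / 2)) by ring.
rewrite [leRHS]EFinM; apply: lee_wpmul2l; first by rewrite lee_fin divr_ge0// ltW.
rewrite EFinD; apply: leeD.
  apply: le_trans (deviation_mgf c4) _.
  by rewrite lee_fin -mulr_natr -mulrA csq mulVf ?mulr1// gt_eqF.
have c4' : `|- c| <= 4^-1 by rewrite normrN.
apply: le_trans (deviation_mgf c4') _.
by rewrite lee_fin sqrrN -mulr_natr -mulrA csq mulVf ?mulr1// gt_eqF.
Qed.

End CoefficientError.

(** * The oracle inequality for model selection *)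

Lemma expR_ge_id {R : realType} (w : R) : w <= expR w.
Proof. by apply: le_trans (expR_ge1Dx w); lra. Qed.

Section OracleInequality.
Context {R : realType} {sigma2 : R} {P : probability R R} {k m d s D : nat}.
Hypotheses (noiseP : noise_class sigma2 P) (sigma2_gt0 : 0 < sigma2).
Hypotheses (half : (k + m)./2 = k) (k16 : (16 <= k)%N) (m_gt0 : (0 < m)%N).
Hypothesis sd : (s <= d)%N.
Context (Jhat : (k + m).-tuple (cube d) -> (k + m).-tuple R -> {set 'I_d}).
Hypothesis Jhat_sel : is_selector s D Jhat.
Context (f : cube d -> R) (J0 : {set 'I_d}).
Hypotheses (f01 : forall x, 0 <= f x <= 1) (fJ0 : supp f \subset J0) (J0s : #|J0| = s).

Let lam := inv_temperature sigma2.
Let N : R := ('C(d, s))%:R.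
Let gap J (X : (k + m).-tuple (cube d)) (e : (k + m).-tuple R) (x : cube d) : R :=
  proj_estimator D J X (responses f X e) x - f x.

(** For (al, be) = (-lam, 2 lam) or (lam, -2 lam), the first sum is a multiple of
the empirical excess loss of the candidate J; ga |g|^2 recenters it so that the
exponential has expectation at most 1. *)
Definition tilt (al be ga : R) J (X : (k + m).-tuple (cube d)) e : R :=
  \sum_(j < k + m | (k <= j)%N)
     (al * gap J X e (tnth X j) ^+ 2 + be * gap J X e (tnth X j) * tnth e j)
  + m%:R * (ga * norm2_sq (gap J X e)).

Lemma gap_le1 J X e x : `|gap J X e x| <= 1.
Proof.
have := proj_estimator_bounds D J X (responses f X e) x; have := f01 x.
by rewrite ler_norml /gap; lra.
Qed.

(** The candidate, hence its error, is computed from the first half only. *)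
Lemma gap_first_half J (X1 : k.-tuple (cube d)) (X2 : m.-tuple (cube d))
    (e1 : k.-tuple R) (e2 : m.-tuple R) :
  gap J [tuple of X1 ++ X2] [tuple of e1 ++ e2] = fun x =>
    clip01 (\sum_(S : {set 'I_d} | (S \subset J) && (#|S| <= D)%N)
       (k%:R^-1 * \sum_(j < k) (f (tnth X1 j) + tnth e1 j) * chi S (tnth X1 j)) * chi S x)
    - f x.
Proof.
apply/funext => x; rewrite /gap /proj_estimator; congr (clip01 _ - _).
apply: eq_bigr => S _; congr (_ * _); rewrite /empirical_coef half; congr (_ * _).
rewrite big_split_ord /= [X in _ + X]big1 ?addr0; last first.
  by move=> j; rewrite ltnNge leq_addr.
rewrite (eq_bigl predT) => [|j]; last by rewrite /= ltn_ord.
by apply: eq_bigr => j _; rewrite tnth_mktuple !(tnth_lshift).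
Qed.

Lemma measurable_gap J X x : measurable_fun setT (fun e => gap J X e x).
Proof.
apply: measurable_funB => //.
apply: (measurableT_comp (measurable_proj_estimator D J X x)).
exact: measurable_responses.
Qed.

Lemma measurable_tilt al be ga J X : measurable_fun setT (fun e => tilt al be ga J X e).
Proof.
apply: measurable_funD.
  apply: measurable_sum_cond => j; apply: measurable_funD.
    by apply: measurable_funM => //; apply: measurable_funX; exact: measurable_gap.
  apply: measurable_funM; last exact: measurable_tnth.
  by apply: measurable_funM => //; exact: measurable_gap.
apply: measurable_funM => //; apply: measurable_funM => //; apply: measurable_funM => //.
by apply: measurable_sum => x; apply: measurable_funX; exact: measurable_gap.
Qed.

Lemma tilt_mgf al be ga J :
  (forall g : cube d -> R, (forall x, `|g x| <= 1) ->
    cube_mean (fun x => expR ((al * g x ^+ 2 + ga * norm2_sq g)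
                        + sigma2 * (be * g x) ^+ 2 / 2)) <= 1) ->
  (EX P (fun X e => expR (tilt al be ga J X e)) <= 1%:E)%E.
Proof.
move=> H; apply: (holdout_mgf noiseP (measurable_gap J) (gap_first_half J)).
move=> X1 e1.
have := H _ (gap_le1 J [tuple of X1 ++ nseq_tuple m [ffun=> false]]
  [tuple of e1 ++ nseq_tuple m 0]).
by rewrite gap_first_half.
Qed.

Let V J X e := expR (tilt (- lam) (2 * lam) (lam / 4) J X e).
Let U X e := expR (tilt lam (- (2 * lam)) (- (3 * lam)) J0 X e).

Let lossE J X e : \sum_(j < k + m | (k <= j)%N)
    (tnth (responses f X e) j - proj_estimator D J X (responses f X e) (tnth X j)) ^+ 2 =
  \sum_(j < k + m | (k <= j)%N) tnth e j ^+ 2 +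
  \sum_(j < k + m | (k <= j)%N)
     (gap J X e (tnth X j) ^+ 2 - 2 * gap J X e (tnth X j) * tnth e j).
Proof.
rewrite -big_split; apply: eq_bigr => j _ /=.
by rewrite tnth_mktuple /gap; ring.
Qed.

Let N_ge1 : 1 <= N. Proof. by rewrite ler1n bin_gt0. Qed.

(** Write T_J for the exponent of V_J.  Then lam/4 m |g|^2 at the selected J is
T_J plus lam times its excess loss.  The latter is at most the excess loss of
J0, by minimality, and w <= e^w bounds it by the recentering plus U.  Also
T_J - ln N <= exp (T_J - ln N) = V_J / N, and V_J is one of the terms of the sum
over all candidates, whatever the selected one is. *)
Lemma selection_pointwise X e :
  lam / 4 * m%:R * norm2_sq (gap (Jhat X (responses f X e)) X e) <=
  ln N + N^-1 * \sum_(J : {set 'I_d} | #|J| == s) V J X e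
  + 3 * lam * m%:R * norm2_sq (gap J0 X e) + U X e.
Proof.
case: Jhat_sel => _ Js Jmin; set J := Jhat _ _.
have N0 : 0 < N by apply: lt_le_trans N_ge1.
have hZ := Jmin X (responses f X e) J0 J0s.
have {hZ} : \sum_(j < k + m | (k <= j)%N)
     (gap J X e (tnth X j) ^+ 2 - 2 * gap J X e (tnth X j) * tnth e j) <=
   \sum_(j < k + m | (k <= j)%N)
     (gap J0 X e (tnth X j) ^+ 2 - 2 * gap J0 X e (tnth X j) * tnth e j).
  move: hZ; rewrite /validation_loss half ler_pM2l; last first.
    by rewrite invr_gt0 ltr0n subn_gt0 -[X in (X < _)%N]addn0 ltn_add2l.
  by rewrite !lossE lerD2l.
have ZE K c : \sum_(j < k + m | (k <= j)%N)
     (c * gap K X e (tnth X j) ^+ 2 + (- (2 * c)) * gap K X e (tnth X j) * tnth e j) =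
   c * \sum_(j < k + m | (k <= j)%N)
     (gap K X e (tnth X j) ^+ 2 - 2 * gap K X e (tnth X j) * tnth e j).
  by rewrite mulr_sumr; apply: eq_bigr => j _; ring.
have VE : V J X e = expR (- lam * \sum_(j < k + m | (k <= j)%N)
     (gap J X e (tnth X j) ^+ 2 - 2 * gap J X e (tnth X j) * tnth e j)
     + m%:R * (lam / 4 * norm2_sq (gap J X e))).
  by rewrite -ZE mulrN opprK.
have UE : U X e = expR (lam * \sum_(j < k + m | (k <= j)%N)
     (gap J0 X e (tnth X j) ^+ 2 - 2 * gap J0 X e (tnth X j) * tnth e j)
     + m%:R * (- (3 * lam) * norm2_sq (gap J0 X e))).
  by rewrite -ZE /U /tilt.
have Vsum : V J X e <= \sum_(K : {set 'I_d} | #|K| == s) V K X e.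
  rewrite (bigD1 J) /=; last by apply/eqP; exact: Js.
  by rewrite lerDl sumr_ge0// => K _; exact: expR_ge0.
move: VE UE; set ZJ := \sum_(j < _ | _) _; set Z0 := \sum_(j < _ | _) _.
set qJ := norm2_sq _; set q0 := norm2_sq _ => VE UE ZZ.
have l0 : 0 < lam by exact: inv_temperature_gt0.
have hU : lam * Z0 + m%:R * (- (3 * lam) * q0) <= U X e.
  by rewrite UE; exact: expR_ge_id.
have hV : - lam * ZJ + m%:R * (lam / 4 * qJ) <= ln N + N^-1 * V J X e.
  have {2}-> : N = expR (ln N) by rewrite lnK.
  by rewrite VE -expRN -expRD -lerBlDl [leLHS]addrC; exact: expR_ge_id.
have hV' : N^-1 * V J X e <= N^-1 * \sum_(K : {set 'I_d} | #|K| == s) V K X e.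
  by rewrite ler_pM2l ?invr_gt0.
have : lam * ZJ <= lam * Z0 by rewrite ler_pM2l.
lra.
Qed.

(** The expectation of the pointwise bound, the estimation error of the oracle
being split into variance and bias.  The additive 2 stands for the expectations
of U and of the average of the V_J. *)
Lemma model_selection_risk :
  (risk P (model_selection_estimator D Jhat) f <=
   (4 / (lam * m%:R) * (ln N + 2) +
    12 * (#|finset (fun S : {set 'I_d} => (S \subset J0) && (#|S| <= D)%N)|%:R
            * (8 * expR (8 + sigma2 / 2) / k%:R)
          + fourier_sobolev f / (4 * D.+1%:R)))%R%:E)%E.
Proof.
set I := finset _; set K := 8 * _ / _; set B0 := fourier_sobolev f / _.
have l0 : 0 < lam by exact: inv_temperature_gt0.
have m0 : 0 < m%:R :> R by rewrite ltr0n.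
have N0 : 0 < N by apply: lt_le_trans N_ge1.
have lnN0 : 0 <= ln N by exact: ln_ge0.
pose c := 4 / (lam * m%:R); have c0 : 0 < c by rewrite divr_gt0// mulr_gt0.
(* c is the reciprocal of the factor lam m / 4 of the loss. *)
have c12 : c * (3 * lam * m%:R) = 12.
  by rewrite /c; field; rewrite !gt_eqF.
have c1 : c * (lam / 4 * m%:R) = 1 by rewrite /c; field; rewrite !gt_eqF.
pose err S X (e : (k + m).-tuple R) :=
  (empirical_coef X (responses f X e) S - fourier_coef f S) ^+ 2.
have err0 S X e : 0 <= err S X e by exact: sqr_ge0.
have merr S X : measurable_fun setT (fun e => err S X e).
  apply: measurable_funX; apply: measurable_funB => //.
  apply: (measurableT_comp (measurable_empirical_coef X S)).
  exact: measurable_responses.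
have V0 J X e : 0 <= V J X e by exact: expR_ge0.
have U0 X e : 0 <= U X e by exact: expR_ge0.
have mV J X : measurable_fun setT (fun e => V J X e).
  by apply: (measurableT_comp (@measurable_expR R)); exact: measurable_tilt.
have mU X : measurable_fun setT (fun e => U X e).
  by apply: (measurableT_comp (@measurable_expR R)); exact: measurable_tilt.
have B00 : 0 <= B0.
  rewrite divr_ge0// mulr_ge0// sumr_ge0// => S _.
  by rewrite mulr_ge0// sqr_ge0.
pose sumV X e := \sum_(J : {set 'I_d} | #|J| == s) V J X e.
pose sumE X e := \sum_(S : {set 'I_d} | S \in I) err S X e.
have sumV0 X e : 0 <= sumV X e by exact: sumr_ge0.
have sumE0 X e : 0 <= sumE X e by exact: sumr_ge0.
have msumV X : measurable_fun setT (fun e => sumV X e).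
  by apply: measurable_sum_cond => J; exact: mV.
have msumE X : measurable_fun setT (fun e => sumE X e).
  by apply: measurable_sum_cond => S; exact: merr.
have EV : (EX P sumV <= N%:E)%E.
  rewrite EX_sum//; apply: (@le_trans _ _ (\sum_(J : {set 'I_d} | #|J| == s) 1%:E)%E).
    apply: lee_sum => J _; apply: tilt_mgf => g g1.
    exact: excess_below_mgf.
  rewrite sumEFin lee_fin sumr_const -[leRHS]/('C(d, s)%:R).
  by rewrite -[X in 'C(X, _)]card_ord -card_draws cardsE.
have EE : (EX P sumE <= (#|I|%:R * K)%:E)%E.
  rewrite EX_sum//; apply: (@le_trans _ _ (\sum_(S in I) K%:E)%E).
    apply: lee_sum => S _; exact: (empirical_coef_error noiseP).
  by rewrite sumEFin lee_fin sumr_const mulr_natl.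
have EU : (EX P U <= 1%:E)%E.
  apply: tilt_mgf => g g1; exact: excess_above_mgf.
apply: (@le_trans _ _ (EX P (fun X e =>
   ((c * ln N + 12 * B0) + c * N^-1 * sumV X e) + 12 * sumE X e + c * U X e)%R)).
  apply: EX_le => X e; first by apply: cube_mean_ge0 => x; exact: sqr_ge0.
  have sel := selection_pointwise X e.
  have pr := proj_estimator_error D X (responses f X e) f01 fJ0.
  have prI : norm2_sq (gap J0 X e) <= sumE X e + B0.
    apply: le_trans pr _; rewrite le_eqVlt; apply/orP; left; apply/eqP.
    by congr (_ + _); apply: eq_bigl => S; rewrite inE.
  rewrite -[leLHS]mul1r -{1}c1 -[_ * norm2_sq _]mulrA.
  apply: (@le_trans _ _ (c * (ln N + N^-1 * sumV X e
      + 3 * lam * m%:R * (sumE X e + B0) + U X e))).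
    rewrite ler_pM2l//; apply: le_trans sel _.
    by rewrite lerD2r lerD2l ler_pM2l// !mulr_gt0.
  rewrite le_eqVlt; apply/orP; left; apply/eqP.
  transitivity (c * ln N + c * N^-1 * sumV X e +
     c * (3 * lam * m%:R) * (sumE X e + B0) + c * U X e); first by ring.
  by rewrite c12; ring.
have cN0 : 0 <= c * N^-1 := divr_ge0 (ltW c0) (ltW N0).
have A0 : 0 <= c * ln N + 12 * B0 by apply: addr_ge0; [exact: mulr_ge0 (ltW c0) lnN0|exact: mulr_ge0].
have mcst (a : R) : measurable_fun setT (fun _ : (k + m).-tuple R => a).
  exact: measurable_cst.
have mZ (a : R) (h : (k + m).-tuple R -> R) :
    measurable_fun setT h -> measurable_fun setT (fun e => a * h e).
  by move=> mh; apply: measurable_funM.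
have T1 X e : 0 <= c * N^-1 * sumV X e by exact: mulr_ge0.
have T2 X e : 0 <= 12 * sumE X e by exact: mulr_ge0.
have T3 X e : 0 <= c * U X e by exact: mulr_ge0 (ltW c0) _.
have T4 X e : 0 <= (c * ln N + 12 * B0) + c * N^-1 * sumV X e by exact: addr_ge0.
have T5 X e : 0 <= (c * ln N + 12 * B0) + c * N^-1 * sumV X e + 12 * sumE X e.
  by exact: addr_ge0.
have M4 X : measurable_fun setT
    (fun e => (c * ln N + 12 * B0) + c * N^-1 * sumV X e).
  by apply: measurable_funD => //; exact: mZ.
have M5 X : measurable_fun setT
    (fun e => (c * ln N + 12 * B0) + c * N^-1 * sumV X e + 12 * sumE X e).
  by apply: measurable_funD => //; exact: mZ.
rewrite (EX_D _ T5 M5 T3 (fun X => mZ _ _ (mU X))).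
rewrite (EX_D _ T4 M4 T2 (fun X => mZ _ _ (msumE X))).
rewrite (EX_D _ (fun X e => A0) (fun X => mcst _) T1 (fun X => mZ _ _ (msumV X))).
rewrite EX_cst (EX_Z _ cN0 sumV0 msumV) (EX_Z _ (ltW c0) U0 mU).
rewrite (EX_Z _ (ler0n R 12) sumE0 msumE).
apply: (@le_trans _ _ ((c * ln N + 12 * B0)%R%:E + (c * N^-1)%R%:E * N%:E
   + 12%:E * (#|I|%:R * K)%R%:E + c%:E * 1%:E)%E).
  have EZ (a : R) (x y : \bar R) : 0 <= a -> (x <= y -> a%:E * x <= a%:E * y)%E.
    by move=> a0; apply: lee_wpmul2l; rewrite lee_fin.
  apply: leeD; last exact: EZ (ltW c0) EU.
  apply: leeD; last exact: EZ.
  by apply: leeD => //; exact: EZ.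
rewrite -!EFinM -!EFinD lee_fin divfK ?gt_eqF// -/c.
rewrite le_eqVlt; apply/orP; left; apply/eqP; ring.
Qed.

End OracleInequality.

(** * The middle-layer family *)

Section ZeroNoise.
Context {R : realType}.

Definition zero_noise : probability R R := dirac (0 : R).

Lemma zero_noise_class (sigma2 : R) : 0 <= sigma2 -> noise_class sigma2 zero_noise.
Proof.
move=> s0; have mE (f : R -> R) : measurable_fun setT f ->
    (\int[zero_noise]_e (f e)%:E)%E = (f 0)%:E.
  by move=> mf; rewrite integral_dirac//= ?diracT ?mul1e//; exact/measurable_EFinP.
split.
- apply/integrableP; split; first exact/measurable_EFinP.
  under eq_integral do rewrite abse_EFin.
  by rewrite (mE Num.norm)// ltry.
- by rewrite unlock (mE idfun)//; exact: measurable_id.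
- move=> t; rewrite /mmt_gen_fun unlock mE//=.
    by rewrite mul0r expR0 lee_fin -[leLHS]expR0 ler_expR divr_ge0// mulr_ge0// sqr_ge0.
  by apply: measurableT_comp => //; exact: mulrr_measurable.
Qed.

Lemma zero_noise_integral n (G : n.-tuple R -> R) :
  (forall e, 0 <= G e) -> measurable_fun setT G ->
  (\int[iid_law zero_noise n]_e (G e)%:E)%E = (G (nseq_tuple n 0))%:E.
Proof.
elim: n G => [|n IH] G G0 mG.
  rewrite integral_dirac//= ?diracT ?mul1e; last exact/measurable_EFinP.
  by congr (G _)%:E; apply: val_inj.
have [mI ->] := integral_iid_S zero_noise G0 mG.
rewrite integral_dirac//= diracT mul1e IH.
- by congr (G _)%:E; apply: val_inj.
- by move=> e; exact: G0.
- exact: measurable_cons_section.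
Qed.

End ZeroNoise.

Section TupleAverages.
Context {R : realType} {d : nat}.

Lemma sum_tuple_prod n (g : cube d -> R) :
  \sum_(X : n.-tuple (cube d)) \prod_(j < n) g (tnth X j) = (\sum_x g x) ^+ n.
Proof.
elim: n => [|n IH].
  rewrite (eq_bigr (fun=> 1)) => [|X _]; last by rewrite big_ord0.
  by rewrite sumr_const card_tuple expn0.
rewrite tuple_sum_cons exprS mulr_suml; apply: eq_bigr => x _.
rewrite -IH mulr_sumr; apply: eq_bigr => X _.
rewrite big_ord_recl; congr (_ * _).
by apply: eq_bigr => j _; rewrite tnthS.
Qed.

Lemma bernoulli_ineq (t : R) n : 0 <= t <= 1 -> 1 - n%:R * t <= (1 - t) ^+ n.
Proof.
move=> /andP[t0 t1]; elim: n => [|n IH]; first by rewrite expr0 mul0r subr0.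
rewrite exprS; apply: (@le_trans _ _ ((1 - t) * (1 - n%:R * t))).
  have : 0 <= n%:R * t * t by rewrite !mulr_ge0.
  by rewrite -natr1; lra.
by rewrite ler_wpM2l// subr_ge0.
Qed.

End TupleAverages.

Section MiddleLayer.
Context {R : realType} {d s : nat} (J0 : {set 'I_d}).
Hypothesis J0s : #|J0| = s.
Implicit Types (x : cube d) (A : {set 'I_d}) (w : {set {set 'I_d}}).

Definition restr x : {set 'I_d} := finset (fun i => (i \in J0) && x i).

Lemma restr_sub x : restr x \subset J0.
Proof. by apply/fintype.subsetP => i; rewrite inE => /andP[]. Qed.

Lemma restr_flip i x : restr (flip i x) =
  if i \in J0 then (if x i then restr x :\ i else i |: restr x)%SET else restr x.
Proof.
apply/setP => j; rewrite inE ffunE; have [->|ji] := eqVneq j i.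
  by case: ifP => iJ; [case: ifP => xi|]; rewrite !inE ?eqxx ?iJ ?xi.
by case: ifP => _; [case: ifP => _|]; rewrite !inE ?ji ?(negbTE ji).
Qed.

(** Adding the indicator of A modulo 2 is a measure-preserving involution of the
cube that exchanges the events that the restriction is A or is empty; so all
2^s restrictions are equally likely. *)
Lemma restr_law A : A \subset J0 ->
  cube_mean (fun x => (restr x == A)%:R) = (2 ^+ s)^-1 :> R.
Proof.
move=> AJ; pose q := cube_mean (fun x => (restr x == finset.set0)%:R) : R.
have shift (B : {set 'I_d}) : B \subset J0 -> cube_mean (fun x => (restr x == B)%:R) = q.
  move=> BJ; pose h x : cube d := [ffun i => x i (+) (i \in B)].
  have hK : involutive h by move=> x; apply/ffunP => i; rewrite !ffunE addbK.
  rewrite -(cube_mean_reindex _ hK); apply: cube_mean_ext => x; congr (_%:R).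
  congr nat_of_bool; apply/eqP/eqP => /setP E; apply/setP => i.
    have := E i; rewrite !inE ffunE.
    have : (i \in B) ==> (i \in J0) by apply/implyP; exact: (fintype.subsetP BJ).
    by case: (i \in J0); case: (i \in B); case: (x i).
  have := E i; rewrite !inE ffunE.
  have : (i \in B) ==> (i \in J0) by apply/implyP; exact: (fintype.subsetP BJ).
  by case: (i \in J0); case: (i \in B); case: (x i).
rewrite shift//.
have : \sum_(B in powerset J0) cube_mean (fun x => (restr x == B)%:R) = 1 :> R.
  rewrite -cube_mean_sum -[RHS](@cube_mean_cst R d); apply: cube_mean_ext => x.
  rewrite (bigD1 (restr x)) ?powersetE ?restr_sub//= eqxx big1 ?addr0//.
  by move=> B /andP[_ /negbTE]; rewrite eq_sym => ->.
rewrite (eq_bigr (fun=> q)) => [|B]; last by rewrite powersetE; exact: shift.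
rewrite sumr_const card_powerset J0s -[q *+ _]mulr_natl natrX => e.
by rewrite -[LHS](mulKf (_ : 2 ^+ s != 0)) ?e ?mulr1// gt_eqF// exprn_gt0.
Qed.

Definition mid_prob (k : nat) : R := cube_mean (fun x => (#|restr x| == k)%:R).

Lemma mid_probE k : mid_prob k = 'C(s, k)%:R / 2 ^+ s.
Proof.
transitivity (\sum_(A : {set 'I_d} | (A \subset J0) && (#|A| == k))
   cube_mean (fun x => (restr x == A)%:R) : R).
  rewrite -cube_mean_sum; apply: cube_mean_ext => x.
  have [xk|xk] := boolP (#|restr x| == k).
    rewrite (bigD1 (restr x)) ?restr_sub ?xk//= eqxx big1 ?addr0//.
    by move=> B /andP[_ /negbTE]; rewrite eq_sym => ->.
  rewrite big1// => A /andP[_ Ak]; case: eqP => // e.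
  by move: xk; rewrite e Ak.
rewrite (eq_bigr (fun=> (2 ^+ s)^-1)) => [|A /andP[AJ _]]; last exact: restr_law.
rewrite sumr_const -[(2 ^+ s)^-1 *+ _]mulr_natl; congr (_%:R * _).
rewrite -J0s -cards_draws.
by apply: eq_card => A; rewrite !inE.
Qed.

Context (k : nat) (a : R).
Hypothesis a01 : 0 <= a <= 1.

(** The set w lists the points of layer k, seen as subsets of J0, with value a. *)
Definition layer_fun w x : R :=
  if (k < #|restr x|)%N || ((#|restr x| == k) && (restr x \in w)) then a else 0.

Lemma layer_fun_bounds w x : 0 <= layer_fun w x <= 1.
Proof. by rewrite /layer_fun; case: ifP => _ //; rewrite lexx ler01. Qed.

Lemma layer_fun_monotone w : coord_nondecreasing (layer_fun w).
Proof.
move=> x y xy; have sub : restr x \subset restr y.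
  apply/fintype.subsetP => i; rewrite !inE => /andP[-> xi] /=.
  by have := xy i; rewrite xi; case: (y i).
have le : (#|restr x| <= #|restr y|)%N by exact: subset_leq_card.
have /andP[a0 _] := a01.
rewrite /layer_fun; case: ifP => hx; last by case: ifP.
case: ifP => // /negbT; rewrite negb_or -leqNgt => /andP[yk].
case/orP: hx => [kx|/andP[/eqP xk xw]].
  by have := leq_trans kx (leq_trans le yk); rewrite ltnn.
have e : restr x = restr y.
  by apply/eqP; rewrite eqEcard sub xk.
by rewrite -e xk eqxx xw.
Qed.

Lemma layer_fun_flip_out w i x : i \notin J0 -> layer_fun w (flip i x) = layer_fun w x.
Proof. by move=> /negbTE iJ; rewrite /layer_fun restr_flip iJ. Qed.

Lemma layer_fun_supp w : supp (layer_fun w) \subset J0.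
Proof.
apply/fintype.subsetP => i; apply: contraLR => iJ.
by apply/supp_flipP => x; exact: layer_fun_flip_out.
Qed.

(** If neither endpoint of the edge is in layer k, the edge does not cross the
layer, as its endpoints lie in the same or in consecutive layers, and f is
constant on it. *)
Lemma layer_fun_diff w i x : (layer_fun w x - layer_fun w (flip i x)) ^+ 2 <=
  a ^+ 2 * ((#|restr x| == k)%:R + (#|restr (flip i x)| == k)%:R).
Proof.
have a2 := sqr_ge0 a.
have d2 : (layer_fun w x - layer_fun w (flip i x)) ^+ 2 <= a ^+ 2.
  rewrite /layer_fun; case: ifP => _; case: ifP => _;
    by rewrite ?subrr ?subr0 ?sub0r ?sqrrN ?expr0n.
have [xk|xk] := boolP (#|restr x| == k); last first.
  have [yk|yk] := boolP (#|restr (flip i x)| == k); last first.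
    suff -> : layer_fun w x = layer_fun w (flip i x).
      by rewrite subrr expr0n /= addr0 mulr0.
    rewrite /layer_fun (negbTE xk) (negbTE yk) !orbF.
    suff -> : (k < #|restr x|)%N = (k < #|restr (flip i x)|)%N by [].
    move: xk yk; rewrite restr_flip; case: ifP => iJ //.
    case: ifP => xi.
      have := cardsD1 i (restr x); rewrite inE iJ xi /=.
      by move: #|_| #|_| => u v -> /eqP uk /eqP vk; lia.
    have := cardsU1 i (restr x); rewrite inE iJ xi /=.
    by move: #|_| #|_| => u v -> /eqP uk /eqP vk; lia.
  by apply: le_trans d2 _; rewrite add0r mulr1.
by apply: le_trans d2 _; rewrite mulrDr mulr1 lerDl mulr_ge0.
Qed.

Lemma layer_fun_energy w : fourier_sobolev (layer_fun w) <= 2 * s%:R * mid_prob k * a ^+ 2.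
Proof.
rewrite fourier_sobolev_flip (bigID (mem J0)) /= [X in _ + X]big1 ?addr0; last first.
  move=> i iJ; rewrite /norm2_sq (@cube_mean_ext _ _ _ (fun=> 0)) ?cube_mean_cst//.
  by move=> x; rewrite layer_fun_flip_out// subrr expr0n.
apply: (@le_trans _ _ (\sum_(i in J0) (2 * mid_prob k * a ^+ 2))).
  apply: ler_sum => i _.
  apply: le_trans (cube_mean_le (layer_fun_diff w i)) _.
  rewrite cube_meanZ cube_meanD (cube_mean_reindex (fun x => (#|restr x| == k)%:R) (@flipK _ i)).
  rewrite -/(mid_prob k); lra.
by rewrite sumr_const J0s -mulr_natl; lra.
Qed.

Lemma layer_fun_class w B : 2 * s%:R * mid_prob k * a ^+ 2 <= B ->
  monotone_class B s (layer_fun w).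
Proof.
move=> EB; split.
- exact: layer_fun_monotone.
- exact: layer_fun_bounds.
- exact: le_trans (layer_fun_energy w) EB.
- by rewrite -J0s subset_leq_card// layer_fun_supp.
Qed.

Definition toggle A w : {set {set 'I_d}} := if A \in w then (w :\ A)%SET else (A |: w)%SET.

Lemma in_toggle A w C : (C \in toggle A w) = if C == A then A \notin w else C \in w.
Proof.
by rewrite /toggle; case: ifP => Aw; rewrite !inE; case: eqP => // ->.
Qed.

Lemma toggleK A : involutive (toggle A).
Proof.
move=> w; apply/setP => C; rewrite !in_toggle eqxx.
by case: eqP => // ->; rewrite negbK.
Qed.

Lemma layer_fun_toggle A w x : restr x != A -> layer_fun (toggle A w) x = layer_fun w x.
Proof. by move=> /negbTE xA; rewrite /layer_fun in_toggle xA. Qed.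

Lemma layer_fun_toggle_self w x : #|restr x| = k ->
  (layer_fun w x - layer_fun (toggle (restr x) w) x) ^+ 2 = a ^+ 2.
Proof.
move=> xk; rewrite /layer_fun in_toggle eqxx xk eqxx ltnn /=.
by case: (restr x \in w); rewrite /= ?subr0 ?sub0r ?sqrrN.
Qed.

(** Toggling the membership of the unobserved point in w leaves the data, hence
the estimate z, unchanged, and moves the value from u to v with |u - v| = a;
then (z - u)^2 + (z - v)^2 >= a^2 / 2. *)
Lemma unobserved_loss n (data : n.-tuple (cube d)) (est : n.-tuple R -> R) x :
  #|restr x| = k -> (forall j, restr (tnth data j) != restr x) ->
  #|{set {set 'I_d}}|%:R * (a ^+ 2 / 4) <=
  \sum_w (est (responses (layer_fun w) data (nseq_tuple n 0)) - layer_fun w x) ^+ 2.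
Proof.
move=> xk unobs.
pose H w := (est (responses (layer_fun w) data (nseq_tuple n 0)) - layer_fun w x) ^+ 2.
rewrite -[leRHS]/(\sum_w H w).
(* The toggled family is the same family, so its total loss is the same. *)
have tog : \sum_w H w = \sum_w H (toggle (restr x) w).
  by rewrite [LHS](reindex_inj (inv_inj (@toggleK (restr x)))).
have : \sum_(w : {set {set 'I_d}}) (a ^+ 2 / 2) <= \sum_w (H w + H (toggle (restr x) w)).
  apply: ler_sum => w _; rewrite /H.
  have -> : responses (layer_fun (toggle (restr x) w)) data (nseq_tuple n 0) =
      responses (layer_fun w) data (nseq_tuple n 0).
    by apply: eq_from_tnth => j; rewrite !tnth_mktuple layer_fun_toggle.
  have := layer_fun_toggle_self w xk.
  set u := layer_fun w x; set v := layer_fun _ x; set z := est _.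
  by have := sqr_ge0 (2 * z - u - v); nra.
rewrite big_split /= -tog sumr_const -mulr_natl; lra.
Qed.

(** The probability is (1 - 2^(-s))^n, bounded below by Bernoulli's inequality. *)
Lemma unobserved_prob n x : n%:R * (2 ^+ s)^-1 <= 2^-1 :> R ->
  2^-1 <= (2 ^+ (d * n))^-1 * \sum_(X : n.-tuple (cube d))
      [forall j, restr (tnth X j) != restr x]%:R :> R.
Proof.
move=> ns.
have -> : \sum_(X : n.-tuple (cube d)) [forall j, restr (tnth X j) != restr x]%:R =
   \sum_(X : n.-tuple (cube d)) \prod_(j < n) (restr (tnth X j) != restr x)%:R :> R.
  apply: eq_bigr => X _.
  have [/forallP h|/forallPn[j]] := boolP [forall j, restr (tnth X j) != restr x].
    by rewrite big1// => j _; rewrite h.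
  by rewrite negbK => h; rewrite (bigD1 j)//= h mul0r.
rewrite (sum_tuple_prod n (fun y => (restr y != restr x)%:R)) exprM -exprVn -exprMn.
rewrite -[X in X ^+ n]/(cube_mean (fun y => (restr y != restr x)%:R)).
have -> : cube_mean (fun y => (restr y != restr x)%:R) = 1 - (2 ^+ s)^-1 :> R.
  rewrite -(restr_law (restr_sub x)) -{2}[1](@cube_mean_cst R d) -[X in _ - X]mul1r -mulNr.
  rewrite -cube_meanZ -cube_meanD; apply: cube_mean_ext => y.
  by case: eqP => _ /=; lra.
apply: le_trans (bernoulli_ineq _ _); first lra.
by rewrite invr_ge0 exprn_ge0//= invf_le1 ?exprn_gt0// exprn_ege1// ler1n.
Qed.

(** The risk averaged over w is at least this large, hence so is one of the risks. *)
Lemma hard_instance n (fhat : estimator n d) : is_estimator fhat ->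
  n%:R * (2 ^+ s)^-1 <= 2^-1 :> R ->
  exists w, ((mid_prob k * a ^+ 2 / 8)%:E <= risk zero_noise fhat (layer_fun w))%E.
Proof.
move=> mfhat ns.
pose Y w (X : n.-tuple (cube d)) := responses (layer_fun w) X (nseq_tuple n 0).
pose r w : R := (2 ^+ (d * n))^-1 * \sum_(X : n.-tuple (cube d))
   norm2_sq (fun x => fhat X (Y w X) x - layer_fun w x).
have riskE w : risk zero_noise fhat (layer_fun w) = (r w)%:E.
  rewrite /risk /r EFinM -sumEFin; congr (_ * _)%E; apply: eq_bigr => X _.
  rewrite (zero_noise_integral (G := fun e => norm2_sq (fun x =>
     fhat X (responses (layer_fun w) X e) x - layer_fun w x)))//.
    by move=> e; apply: cube_mean_ge0 => x; exact: sqr_ge0.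
  apply: measurable_funM => //; apply: measurable_sum => x.
  apply: measurable_funX; apply: measurable_funB => //.
  by apply: (measurableT_comp (mfhat X x)); exact: measurable_responses.
suff [w rw] : exists w, mid_prob k * a ^+ 2 / 8 <= r w.
  by exists w; rewrite riskE lee_fin.
apply/existsP; apply: contraT => /existsPn small.
suff : \sum_(w : {set {set 'I_d}}) (mid_prob k * a ^+ 2 / 8) <= \sum_w r w.
  rewrite leNgt => /negP[]; apply: ltr_sum => [|w _]; last by rewrite ltNge small.
  by apply/hasP; exists finset.set0; rewrite ?mem_index_enum.
pose M : R := #|{set {set 'I_d}}|%:R.
rewrite sumr_const -[(mid_prob k * a ^+ 2 / 8) *+ _]mulr_natl -/M.
have M0 : 0 <= M by exact: ler0n.
have a2 : 0 <= a ^+ 2 by exact: sqr_ge0.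
apply: (@le_trans _ _ (cube_mean (fun x => (#|restr x| == k)%:R *
   (M * (a ^+ 2 / 4) * ((2 ^+ (d * n))^-1 * \sum_(X : n.-tuple (cube d))
      [forall j, restr (tnth X j) != restr x]%:R))))).
  apply: (@le_trans _ _ (cube_mean (fun x => (M * (a ^+ 2 / 4) / 2) * (#|restr x| == k)%:R))).
    rewrite cube_meanZ -/(mid_prob k) le_eqVlt; apply/orP; left; apply/eqP.
    by move: (mid_prob k) M {M0} => p M; field.
  apply: cube_mean_le => x; rewrite [leRHS]mulrC ler_wpM2r//.
  apply: ler_wpM2l; last exact: unobserved_prob.
  by rewrite mulr_ge0// divr_ge0.
have -> : \sum_w r w = cube_mean (fun x => (2 ^+ (d * n))^-1 *
   \sum_(X : n.-tuple (cube d)) \sum_w (fhat X (Y w X) x - layer_fun w x) ^+ 2).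
  rewrite cube_meanZ /r -mulr_sumr; congr (_ * _).
  rewrite exchange_big cube_mean_sum; apply: eq_bigr => X _.
  by rewrite cube_mean_sum.
apply: cube_mean_le => x.
have -> (u v w z : R) : u * (v * (w * z)) = w * (u * v * z) by ring.
rewrite ler_pM2l ?invr_gt0 ?exprn_gt0// !mulr_sumr.
apply: ler_sum => X _.
have H0 : 0 <= \sum_w (fhat X (Y w X) x - layer_fun w x) ^+ 2.
  by apply: sumr_ge0 => w _; exact: sqr_ge0.
have [/eqP xk|] := boolP (#|restr x| == k); last by rewrite !(mul0r, mulr0).
have [/forallP un|] := boolP [forall j, restr (tnth X j) != restr x];
  last by rewrite !(mul0r, mulr0).
rewrite /= !(mul1r, mulr1).
exact: (unobserved_loss (fun Y => fhat X Y x) xk un).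
Qed.

End MiddleLayer.

(** * Binomial estimates *)

Section Combinatorics.

Lemma central_bin_step m :
  (m.+1 * 'C(m.+1.*2, m.+1) = 2 * (m.*2.+1 * 'C(m.*2, m)))%N /\
  ('C(m.+1.*2, m.+1) = 2 * 'C(m.*2.+1, m))%N.
Proof.
have sym : 'C(m.*2.+1, m.+1) = 'C(m.*2.+1, m).
  rewrite -[in LHS]bin_sub; last by rewrite ltnS -addnn leq_addr.
  by congr ('C(_, _)); rewrite subSS -addnn addnK.
have e : ('C(m.+1.*2, m.+1) = 2 * 'C(m.*2.+1, m))%N.
  by rewrite doubleS binS sym addnn mul2n.
split=> //; rewrite e -sym mulnCA; congr (2 * _)%N.
by rewrite -mul_bin_diag.
Qed.

(** The induction step is (2 m + 1)^2 >= 4 m (m + 1), which is why the factor is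
4 m and the induction starts at 1. *)
Lemma central_bin_even m : (0 < m)%N -> (16 ^ m <= 'C(m.*2, m) ^ 2 * (4 * m))%N.
Proof.
elim: m => // -[|m] IH _ //; have {}IH := IH isT.
have [e _] := central_bin_step m.+1; move: e IH.
set b := 'C(_, _); set b' := 'C(_, _); set E := (16 ^ m.+1)%N => e IH.
rewrite expnS -/E -(leq_pmul2l (_ : 0 < m.+2 ^ 2)%N) ?expn_gt0//.
have -> : (m.+2 ^ 2 * (b ^ 2 * (4 * m.+2)) = (m.+2 * b) ^ 2 * (4 * m.+2))%N by ring.
rewrite e -/b'.
apply: (@leq_trans (16 * m.+2 * (m.+2 * E))); first by rewrite !expnS; nia.
have -> : ((2 * (m.+1.*2.+1 * b')) ^ 2 * (4 * m.+2) =
   16 * m.+2 * (m.+1.*2.+1 ^ 2 * b' ^ 2))%N by ring.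
rewrite leq_mul2l; apply/orP; right.
apply: (@leq_trans (m.+2 * (b' ^ 2 * (4 * m.+1)))); first by rewrite leq_mul2l IH orbT.
rewrite mulnCA [leqRHS]mulnC leq_mul2l; apply/orP; right.
by rewrite -mul2n !expnS expn0; nia.
Qed.

Lemma central_bin_lower s : (0 < s)%N -> (4 ^ s <= 'C(s, s./2) ^ 2 * (2 * s.+1))%N.
Proof.
have pow4 m : (4 ^ m.*2 = 16 ^ m)%N by rewrite -mul2n expnM.
rewrite -(odd_double_half s); move: (s./2) => m; case: (odd s) => /=.
  rewrite add1n /= uphalf_double => _; have [_ cb] := central_bin_step m.
  have := central_bin_even (ltn0Sn m).
  rewrite cb !expnS pow4; move: ('C(_, _)) (16 ^ m)%N => b E.
  by rewrite !expn0 -!mul2n; nia.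
rewrite add0n doubleK double_gt0 => m0; apply: leq_trans (_ : _ <= 'C(m.*2, m) ^ 2 * (4 * m))%N _.
  by rewrite pow4; exact: central_bin_even.
by rewrite leq_mul2l; apply/orP; right; lia.
Qed.

Lemma superset_of_card d s (A : {set 'I_d}) : (#|A| <= s)%N -> (s <= d)%N ->
  exists J : {set 'I_d}, A \subset J /\ #|J| = s.
Proof.
move=> As sd; have cA : #|(~: A)%SET| = (d - #|A|)%N.
  by rewrite cardsCs finset.setCK card_ord.
have : (0 < #|finset (fun B : {set 'I_d} => (B \subset (~: A)%SET) && (#|B| == s - #|A|)%N)|)%N.
  by rewrite cards_draws cA bin_gt0 leq_sub2r.
move=> /card_gt0P[B]; rewrite inE => /andP[BA /eqP Bc].
exists (A :|: B)%SET; split; first exact: finset.subsetUl.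
rewrite cardsU Bc.
suff -> : (A :&: B)%SET = finset.set0 by rewrite cards0 subn0 subnKC.
by apply/eqP; rewrite finset.setI_eq0 disjoint_sym finset.disjoints_subset.
Qed.

(** The sets are counted by the generating function of the subsets of J, which
gives weight x^|S| >= x^D to each S. *)
Lemma low_degree_count {R : realType} d s D (J : {set 'I_d}) (x : R) :
  0 < x <= 1 -> #|J| = s ->
  #|finset (fun S : {set 'I_d} => (S \subset J) && (#|S| <= D)%N)|%:R * x ^+ D
  <= (1 + x) ^+ s.
Proof.
move=> /andP[x0 x1] Js.
have -> : (1 + x) ^+ s = \prod_(i < d) ((if i \in J then x else 0) + 1).
  rewrite (bigID (mem J)) /= [X in _ * X]big1 ?mulr1; last first.
    by move=> i /negbTE ->; rewrite add0r.
  rewrite (eq_bigr (fun=> 1 + x)) => [|i ->]; last by rewrite addrC.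
  by rewrite prodr_const Js.
rewrite bigA_distr -sum1_card natr_sum mulr_suml.
rewrite [leLHS]big_mkcond; apply: ler_sum => S _.
case: ifP => [|_]; last by apply: prodr_ge0 => i _; case: ifP => // _; case: ifP => // _; exact: ltW.
rewrite inE => /andP[SJ SD]; rewrite mul1r.
rewrite (bigID (mem S)) /= [X in _ * X]big1 ?mulr1; last by move=> i /negbTE ->.
rewrite (eq_bigr (fun=> x)) => [|i iS]; last by rewrite iS (fintype.subsetP SJ).
by rewrite prodr_const ler_wiXn2l// ltW.
Qed.

End Combinatorics.

(** * Measurable selectors *)

Section Selector.
Context {R : realType}.

Lemma measurable_finite_decision disp (T : measurableType disp) (I : finType)
    (b : I -> T -> bool) (phi : pred {ffun I -> bool}) :
  (forall i, measurable [set y | b i y]) ->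
  measurable [set y | phi [ffun i => b i y]].
Proof.
move=> mb.
rewrite (_ : [set y | _] = \bigcup_(v in [set v : {ffun I -> bool} | phi v])
   \bigcap_(i in [set: I]) [set y | b i y = v i]); last first.
  apply/seteqP; split=> y /=.
    by move=> h; exists [ffun i => b i y] => // i _ /=; rewrite ffunE.
  move=> [v /= pv vb]; suff -> : [ffun i => b i y] = v by [].
  by apply/ffunP => i; rewrite ffunE; exact: vb.
apply: fin_bigcup_measurable => [|v _]; first exact: finite_finset.
apply: fin_bigcap_measurable => [|i _]; first exact: finite_finset.
case: (v i); first exact: mb.
rewrite (_ : [set y | _] = ~` [set y | b i y]); first exact: measurableC.
by apply/seteqP; split=> y /=; case: (b i y).
Qed.

Context {n d : nat}.

Lemma measurable_validation_loss D J (X : n.-tuple (cube d)) :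
  measurable_fun setT (fun Y : n.-tuple R => validation_loss D J X Y).
Proof.
apply: measurable_funM => //; apply: measurable_sum_cond => j.
apply: measurable_funX; apply: measurable_funB; first exact: measurable_tnth.
exact: measurable_proj_estimator.
Qed.

(** The outcome of the selection depends on the responses only through the finite
table of comparisons between losses, whose entries are measurable. *)
Lemma selector_exists s D : (s <= d)%N ->
  exists Jhat : n.-tuple (cube d) -> n.-tuple R -> {set 'I_d}, is_selector s D Jhat.
Proof.
move=> sd; have c0 : (#|finset.set0 : {set 'I_d}| <= s)%N by rewrite cards0.
have [J0 [_ J0s]] := superset_of_card c0 sd.
pose v (X : n.-tuple (cube d)) (Y : n.-tuple R) :=
  [ffun p : {set 'I_d} * {set 'I_d} => validation_loss D p.1 X Y <= validation_loss D p.2 X Y].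
pose best (w : {ffun {set 'I_d} * {set 'I_d} -> bool}) (J : {set 'I_d}) :=
  (#|J| == s) && [forall K : {set 'I_d}, (#|K| == s) ==> w (J, K)].
pose sel w := odflt J0 [pick J | best w J].
have selP X Y : best (v X Y) (sel (v X Y)).
  rewrite /sel; case: pickP => // none.
  have J0s' : #|J0| == s by apply/eqP.
  case: (@arg_minP _ _ _ J0 (fun J : {set 'I_d} => #|J| == s)
    (fun J => validation_loss D J X Y) J0s') => J Js Jmin.
  have := none J; rewrite /best Js /= => /negbT /forallPn[K].
  by rewrite negb_imply ffunE => /andP[Ks]; rewrite Jmin.
exists (fun X Y => sel (v X Y)); split.
- move=> X J; rewrite (_ : [set Y | _] = [set Y | sel (v X Y) == J]); last first.
    by apply/seteqP; split=> Y /= /eqP.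
  apply: (@measurable_finite_decision _ _ _
    (fun (p : {set 'I_d} * {set 'I_d}) Y => validation_loss D p.1 X Y <= validation_loss D p.2 X Y)
    (fun w => sel w == J)) => p.
  rewrite -[X in measurable X]setTI.
  apply: (measurable_fun_ler (measurable_validation_loss D p.1 X)
     (measurable_validation_loss D p.2 X)) => //.
- by move=> X Y; case/andP: (selP X Y) => /eqP.
- move=> X Y J Js; case/andP: (selP X Y) => _ /forallP/(_ J).
  by rewrite Js eqxx /= ffunE.
Qed.

Lemma model_selection_is_estimator s D (Jhat : n.-tuple (cube d) -> n.-tuple R -> {set 'I_d}) :
  is_selector s D Jhat -> is_estimator (model_selection_estimator D Jhat).
Proof.
move=> [mJ _ _] X x.
rewrite (_ : (fun _ => _) = fun Y => \sum_(J : {set 'I_d})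
    \1_[set Y | Jhat X Y = J] Y * proj_estimator D J X Y x).
  apply: measurable_sum => J; apply: measurable_funM.
    exact: measurable_indic.
  exact: measurable_proj_estimator.
apply/funext => Y; rewrite (bigD1 (Jhat X Y))//= indicE mem_set//= mul1r.
rewrite big1 ?addr0// => J JJ; rewrite indicE memNset ?mul0r//=.
by move=> e; move: JJ; rewrite e eqxx.
Qed.

End Selector.

(** * Choice of the constants *)

Section Asymptotics.
Context {R : realType}.

Lemma ln2_bounds : 0 < ln 2 :> R /\ ln 2 <= 1 :> R.
Proof.
split; first by rewrite ln_gt0// ltr1n.
by rewrite -[2]/(1 + 1) le_ln1Dx// ltrNl ltrN10.
Qed.

Definition size_factor (C0 : R) : R := `|C0| + 1.
(** The weight x at which [low_degree_count] is applied: as s is at most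
[size_factor C0] * log2 n, the factor (1 + x)^s <= exp (x s) is at most n^(1/4).
The ratio eta = [degree_ratio C0] satisfies eta (1 - ln x) = x, so that
x^(-eta s) is at most n^(1/4) too. *)
Definition fugacity (C0 : R) : R := ln 2 / (4 * size_factor C0).
Definition degree_ratio (C0 : R) : R :=
  ln 2 / (4 * size_factor C0 * (1 - ln (fugacity C0))).

Lemma size_factor_ge1 C0 : 1 <= size_factor C0.
Proof. by rewrite /size_factor lerDr. Qed.

Lemma fugacity_bounds C0 : 0 < fugacity C0 <= 4^-1.
Proof.
have [L0 L1] := ln2_bounds; have C1 := size_factor_ge1 C0.
rewrite /fugacity divr_gt0//=; last by lra.
by rewrite ler_pdivrMr; lra.
Qed.

Lemma ln_fugacity_lt0 C0 : ln (fugacity C0) < 0.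
Proof. by have /andP[x0 x1] := fugacity_bounds C0; rewrite ln_lt0// x0 /=; lra. Qed.

Lemma degree_ratio_bounds C0 : 0 < degree_ratio C0 < 2^-1.
Proof.
have [L0 L1] := ln2_bounds; have C1 := size_factor_ge1 C0.
have x0 := ln_fugacity_lt0 C0.
have d0 : 4 <= 4 * size_factor C0 * (1 - ln (fugacity C0)) by nra.
rewrite /degree_ratio divr_gt0//=; last by lra.
by rewrite ltr_pdivrMr; lra.
Qed.

Lemma size_bound C0 n s : (0 < n)%N -> s%:R <= C0 * log2 n%:R ->
  ln 2 * s%:R <= size_factor C0 * ln n%:R :> R.
Proof.
move=> n0 sC; have [L0 L1] := ln2_bounds.
have t0 : 0 <= ln n%:R :> R by rewrite ln_ge0// ler1n.
have : ln 2 * s%:R <= C0 * ln n%:R.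
  have -> : C0 * ln n%:R = ln 2 * (C0 * log2 n%:R) by rewrite /log2; field; rewrite gt_eqF.
  by rewrite ler_pM2l.
move/le_trans; apply; rewrite ler_wpM2r// /size_factor.
by have := ler_norm C0; lra.
Qed.

Lemma low_degree_dimension C0 n s d D (J : {set 'I_d}) :
  (0 < n)%N -> s%:R <= C0 * log2 n%:R -> D%:R <= degree_ratio C0 * s%:R ->
  #|J| = s ->
  #|finset (fun S : {set 'I_d} => (S \subset J) && (#|S| <= D)%N)|%:R
  <= expR (ln n%:R / 2) :> R.
Proof.
move=> n0 sC DE Js; have [L0 L1] := ln2_bounds; have C1 := size_factor_ge1 C0.
have sL := size_bound n0 sC.
set x := fugacity C0; have /andP[x0 x1] := fugacity_bounds C0; rewrite -/x in x0 x1.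
have lx := ln_fugacity_lt0 C0; rewrite -/x in lx.
have xI : 0 < x <= 1 by rewrite x0 /=; lra.
have := low_degree_count D xI Js; set N := #|_|%:R => h.
have xD : x ^+ D = expR (D%:R * ln x) by rewrite expRM_natl lnK.
rewrite xD in h.
have -> : N = N * expR (D%:R * ln x) * expR (- (D%:R * ln x)).
  by rewrite -mulrA -expRD subrr expR0 mulr1.
apply: (@le_trans _ _ (expR (s%:R * x) * expR (- (D%:R * ln x)))).
  rewrite ler_pM2r ?expR_gt0//; apply: le_trans h _.
  by rewrite expRM_natl lerXn2r ?nnegrE ?expR_ge0 ?expR_ge1Dx//; lra.
rewrite -expRD ler_expR.
have cx : x * (4 * size_factor C0) = ln 2 by rewrite /x /fugacity divfK// gt_eqF//; lra.
have ce : degree_ratio C0 * (4 * size_factor C0) * (1 - ln x) = ln 2.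
  rewrite /degree_ratio -/x; field; rewrite !gt_eqF//; lra.
have sx : s%:R * x <= ln n%:R / 4.
  have c4 : 0 < 4 * size_factor C0 by lra.
  by rewrite -(ler_pM2r c4) -mulrA cx; lra.
have e1 : degree_ratio C0 * (1 - ln x) = x.
  have c4 : 4 * size_factor C0 != 0 by rewrite gt_eqF//; lra.
  by apply: (mulIf c4); rewrite cx -ce; ring.
have : - (D%:R * ln x) <= s%:R * x.
  have /andP[e0 _] := degree_ratio_bounds C0.
  apply: (@le_trans _ _ (degree_ratio C0 * s%:R * - ln x)).
    by rewrite -mulrN ler_pM2r// oppr_gt0.
  have -> : s%:R * x = degree_ratio C0 * s%:R * - ln x + degree_ratio C0 * s%:R.
    by rewrite -{1}e1; ring.
  by rewrite lerDl mulr_ge0// ltW.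
lra.
Qed.

Definition variance_factor (sigma2 : R) : R := expR (8 + sigma2 / 2).

(** With r = n^(1/4), the lower order terms of the risk are at most
(288 K + 16 / lam) / r^2, while B / s is at least B ln 2 / (4 C r) for the size
factor C.  The former is smaller once r exceeds this threshold. *)
Definition slack_threshold (C0 sigma2 B : R) : R :=
  (288 * variance_factor sigma2 + 16 / inv_temperature sigma2) * (4 * size_factor C0)
  / (B * ln 2).

(** Everything in the risk bound that is neither bias nor ln C(d, s) / n is
swallowed by a single B / s. *)
Lemma lower_order_terms (C0 sigma2 B : R) n k m s (I : R) :
  0 < sigma2 -> 0 < B -> (0 < n)%N -> (0 < s)%N -> (0 < k)%N -> (0 < m)%N ->
  (n <= 3 * k)%N -> (n <= 2 * m)%N ->
  s%:R <= C0 * log2 n%:R -> I <= expR (ln n%:R / 2) ->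
  4 * slack_threshold C0 sigma2 B <= ln n%:R ->
  96 * variance_factor sigma2 * I / k%:R + 8 / (inv_temperature sigma2 * m%:R) <= B / s%:R.
Proof.
move=> sg0 B0 n0 s0 k0 m0 nk nm sC Ile thr.
have [L0 L1] := ln2_bounds; have C1 := size_factor_ge1 C0.
have sL := size_bound n0 sC.
have l0 := inv_temperature_gt0 sg0; set lam := inv_temperature sigma2 in l0 *.
set K := variance_factor sigma2; have K0 : 0 < K by exact: expR_gt0.
have nR : 0 < n%:R :> R by rewrite ltr0n.
have kR : 0 < k%:R :> R by rewrite ltr0n.
have mR : 0 < m%:R :> R by rewrite ltr0n.
have sR : 0 < s%:R :> R by rewrite ltr0n.
(* r is the fourth root of n; both sides are compared as powers of r. *)
pose r : R := expR (ln n%:R / 4).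
have r0 : 0 < r by exact: expR_gt0.
have r2 : expR (ln n%:R / 2) = r ^+ 2 by rewrite /r expr2 -expRD; congr expR; lra.
have r4 : n%:R = r ^+ 2 * r ^+ 2 by rewrite -r2 -expRD -[LHS]lnK ?posrE//; congr expR; lra.
have r1 : 1 <= r by rewrite /r -[leLHS]expR0 ler_expR divr_ge0// ln_ge0// ler1n.
have rt : ln n%:R / 4 <= r by have := expR_ge1Dx (ln n%:R / 4 : R); rewrite -/r; lra.
have A1 : slack_threshold C0 sigma2 B <= r by lra.
pose A : R := 288 * K + 16 / lam.
have A0 : 0 < A by apply: addr_gt0; [apply: mulr_gt0; rewrite ?ltr0n|apply: divr_gt0; rewrite ?ltr0n].
have rr0 : 0 < r ^+ 2 by rewrite exprn_gt0.
have step1 : 96 * K * I / k%:R + 8 / (lam * m%:R) <= A / r ^+ 2.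
  have -> : A / r ^+ 2 = 288 * K / r ^+ 2 + 16 / lam / r ^+ 2 by exact: mulrDl.
  apply: lerD.
    rewrite ler_pdivrMr// [leRHS]mulrAC ler_pdivlMr//.
    have nk' : r ^+ 2 * r ^+ 2 <= 3 * k%:R by rewrite -r4 -natrM ler_nat.
    have : K * (I * r ^+ 2) <= K * (3 * k%:R).
      rewrite ler_pM2l//; apply: le_trans nk'; rewrite ler_pM2r//; rewrite r2 in Ile; exact: Ile.
    lra.
  have nm' : r ^+ 2 <= 2 * m%:R.
    apply: (@le_trans _ _ n%:R); last by rewrite -natrM ler_nat.
    by rewrite r4 ler_peMr ?exprn_ege1// ltW.
  rewrite invfM mulrA ler_pdivrMr// [leRHS]mulrAC ler_pdivlMr//.
  have : lam^-1 * r ^+ 2 <= lam^-1 * (2 * m%:R) by rewrite ler_pM2l// invr_gt0.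
  lra.
apply: le_trans step1 _.
rewrite ler_pdivrMr// [leRHS]mulrAC ler_pdivlMr//.
have hs : ln 2 * s%:R <= 4 * size_factor C0 * r.
  apply: le_trans sL _; rewrite mulrAC mulrC -mulrA.
  have : size_factor C0 * (ln n%:R / 4) <= size_factor C0 * r by rewrite ler_pM2l//; lra.
  lra.
have hA : A * (4 * size_factor C0) <= B * ln 2 * r.
  by move: A1; rewrite /slack_threshold -/K -/lam -/A ler_pdivrMr ?mulr_gt0// [r * _]mulrC.
have : ln 2 * (A * s%:R) <= ln 2 * (B * r ^+ 2).
  have -> : ln 2 * (A * s%:R) = A * (ln 2 * s%:R) by ring.
  apply: (@le_trans _ _ (A * (4 * size_factor C0 * r))); first by rewrite ler_pM2l.
  have -> : A * (4 * size_factor C0 * r) = (A * (4 * size_factor C0)) * r by ring.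
  have -> : ln 2 * (B * r ^+ 2) = (B * ln 2 * r) * r by ring.
  by rewrite ler_pM2r.
by rewrite ler_pM2l.
Qed.

Lemma half_split n : (32 <= n)%N -> exists k m, [/\ n = (k + m)%N, (k + m)./2 = k,
  (16 <= k)%N, (n <= 3 * k)%N & (n <= 2 * m)%N].
Proof.
move=> n32; exists n./2, (n - n./2)%N.
have e := odd_double_half n; have := leq_b1 (odd n).
have le : (n./2 <= n)%N by lia.
by rewrite subnKC//; split => //; lia.
Qed.

(** * The minimax rate *)

Definition upper_factor (C0 sigma2 : R) : R :=
  3 / degree_ratio C0 + 1 + 8 / inv_temperature sigma2.

Lemma model_selection_upper (C0 sigma2 B : R) n s d
    (Jhat : n.-tuple (cube d) -> n.-tuple R -> {set 'I_d}) :
  0 < sigma2 -> 0 < B -> (32 <= n)%N -> (0 < s)%N -> (s <= d)%N ->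
  s%:R <= C0 * log2 n%:R ->
  4 * slack_threshold C0 sigma2 B <= ln n%:R ->
  is_selector s (Num.truncn (degree_ratio C0 * s%:R)) Jhat ->
  (worst_risk sigma2 (monotone_class B s)
     (model_selection_estimator (Num.truncn (degree_ratio C0 * s%:R)) Jhat) <=
   (upper_factor C0 sigma2 * (B / s%:R + ln ('C(d, s)%:R) / n%:R))%:E)%E.
Proof.
move=> sg0 B0 n32 s0 sd sC thr; set eta := degree_ratio C0; set D := Num.truncn _.
have [k [m [En half k16 nk nm]]] := half_split n32.
have n0 : (0 < n)%N by exact: leq_trans n32.
have m0 : (0 < m)%N by lia.
move: Jhat nk nm n32 n0 sC thr; rewrite En => Jhat nk nm n32 n0 sC thr sel.
apply: ge_ereal_sup => _ [f [fmon f01 fB fs] <-].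
apply: ge_ereal_sup => _ [P noiseP <-].
have [J0 [fJ0 J0s]] := superset_of_card fs sd.
apply: le_trans (model_selection_risk noiseP sg0 half k16 m0 sd sel f01 fJ0 J0s) _.
rewrite lee_fin; set I := #|_|%:R; set lam := inv_temperature sigma2; set N := 'C(d, s)%:R.
have /andP[e0 _] := degree_ratio_bounds C0; rewrite -/eta in e0.
have sR : 0 < s%:R :> R by rewrite ltr0n.
have es : 0 < eta * s%:R by rewrite mulr_gt0.
have DE : D%:R <= eta * s%:R by rewrite truncn_le// ltW.
have DE' : eta * s%:R < D.+1%:R by rewrite truncnS_gt.
have Ile : I <= expR (ln (k + m)%N%:R / 2) by exact: (low_degree_dimension n0 sC DE).
have k0 : (0 < k)%N by exact: leq_trans k16.
have := lower_order_terms sg0 B0 n0 s0 k0 m0 nk nm sC Ile thr.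
rewrite -/lam -[expR _]/(variance_factor sigma2); set K := variance_factor _.
have l0 : 0 < lam := inv_temperature_gt0 sg0.
have kR : 0 < k%:R :> R by rewrite ltr0n.
have mR : 0 < m%:R :> R by rewrite ltr0n.
have nR : 0 < (k + m)%N%:R :> R by rewrite ltr0n.
have lnN : 0 <= ln N by rewrite ln_ge0// ler1n bin_gt0.
have bias : fourier_sobolev f / (4 * D.+1%:R) <= B / (4 * (eta * s%:R)).
  apply: (@le_trans _ _ (B / (4 * D.+1%:R))); first by rewrite ler_pM2r ?invr_gt0.
  rewrite ler_pM2l// lef_pV2; last 2 first.
  - by rewrite posrE mulr_gt0.
  - by rewrite posrE mulr_gt0.
  by rewrite ler_pM2l// ltW.
have sel_cost : 4 / (lam * m%:R) * ln N <= 8 / lam * (ln N / (k + m)%N%:R).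
  have -> : 4 / (lam * m%:R) * ln N = (4 / lam * ln N) / m%:R by rewrite invfM; ring.
  have -> : 8 / lam * (ln N / (k + m)%N%:R) = (4 / lam * ln N) * (2 / (k + m)%N%:R) by ring.
  apply: ler_wpM2l; first by rewrite mulr_ge0// divr_ge0// ltW.
  by rewrite -[leLHS]mul1r ler_pdivrMr// mulrAC ler_pdivlMr// mul1r -natrM ler_nat.
move=> low.
have bE : 12 * (B / (4 * (eta * s%:R))) = 3 / eta * (B / s%:R).
  by field; rewrite !gt_eqF.
have c1 : 0 <= 8 / lam * (B / s%:R) by rewrite mulr_ge0// divr_ge0// ltW.
have c2 : 0 <= 3 / eta * (ln N / (k + m)%N%:R) by rewrite mulr_ge0// divr_ge0// ltW.
have c3 : 0 <= ln N / (k + m)%N%:R by rewrite divr_ge0// ltW.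
have vE : 12 * (I * (8 * K / k%:R)) = 96 * K * I / k%:R by ring.
have wE : 4 / (lam * m%:R) * 2 = 8 / (lam * m%:R) by ring.
rewrite [4 / (lam * m%:R) * (ln N + 2)]mulrDr wE mulrDr vE /upper_factor -/eta -/lam.
rewrite (_ : (3 / eta + 1 + 8 / lam) * (B / s%:R + ln N / (k + m)%N%:R) =
   3 / eta * (B / s%:R) + B / s%:R + 8 / lam * (ln N / (k + m)%N%:R)
   + (8 / lam * (B / s%:R) + 3 / eta * (ln N / (k + m)%N%:R) + ln N / (k + m)%N%:R)); last by ring.
move: bias sel_cost low bE c1 c2 c3; clear.
set b := fourier_sobolev f / _; set b' := B / (4 * _); set x1 := 3 / eta * _.
set x2 := 4 / _ * _; set x3 := 8 / lam * (ln N / _); set x4 := 96 * _ * _ / _.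
set x5 := 8 / (lam * _); set x6 := B / _; set x7 := 8 / lam * _.
set x8 := 3 / eta * _; set x9 := ln N / _.
move: b b' x1 x2 x3 x4 x5 x6 x7 x8 x9 => b b' x1 x2 x3 x4 x5 x6 x7 x8 x9; lra.
Qed.

(** The amplitude a is the largest one that the energy budget allows. *)
Lemma minimax_lower (sigma2 B : R) n s d :
  0 <= sigma2 -> 0 < B -> (0 < s)%N -> (s <= d)%N ->
  n%:R * (2 ^+ s)^-1 <= 2^-1 :> R -> B ^+ 2 <= s%:R ->
  ((16^-1 * (B / s%:R))%:E <= minimax_risk sigma2 n (@monotone_class R d B s))%E.
Proof.
move=> sg0 B0 s0 sd ns Bs.
have sR : 0 < s%:R :> R by rewrite ltr0n.
have c0 : (#|finset.set0 : {set 'I_d}| <= s)%N by rewrite cards0.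
have [J0 [_ J0s]] := superset_of_card c0 sd.
pose p : R := @mid_prob R d J0 s./2.
have pE : p = 'C(s, s./2)%:R / 2 ^+ s by exact: mid_probE.
have p0 : 0 < p.
  rewrite pE divr_gt0 ?exprn_gt0// ltr0n bin_gt0.
  by have := odd_double_half s; lia.
have sp0 : 0 < 2 * s%:R * p by rewrite mulr_gt0// mulr_gt0.
have pB : B <= 2 * s%:R * p.
  suff B2 : B ^+ 2 <= (2 * s%:R * p) ^+ 2.
    by rewrite -(@ler_pXn2r _ 2)// nnegrE ltW.
  apply: le_trans Bs _.
  have := central_bin_lower s0; rewrite -(ler_nat R) natrX natrM natrX.
  have -> : 'C(s, s./2)%:R = p * 2 ^+ s by rewrite pE divfK// gt_eqF// exprn_gt0.
  rewrite (_ : 4%:R ^+ s = (2 ^+ s) ^+ 2 :> R); last first.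
    by rewrite -exprM mulnC exprM; congr (_ ^+ _); ring.
  have -> (u v w : R) : (u * v) ^+ 2 * w = u ^+ 2 * w * v ^+ 2 by ring.
  rewrite -[leLHS]mul1r ler_pM2r ?exprn_gt0// => h.
  have s1 : (2 * s.+1)%N%:R <= 4 * s%:R :> R by rewrite -natrM ler_nat; lia.
  have : 1 <= p ^+ 2 * (4 * s%:R) by apply: le_trans h _; rewrite ler_pM2l// exprn_gt0.
  rewrite -(ler_pM2r sR) mul1r; lra.
pose a : R := Num.sqrt (B / (2 * s%:R * p)).
have a2 : a ^+ 2 = B / (2 * s%:R * p) by rewrite sqr_sqrtr// divr_ge0// ltW.
have a01 : 0 <= a <= 1.
  rewrite sqrtr_ge0 -sqrtr1 ler_wsqrtr//; by rewrite ler_pdivrMr// mul1r.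
have aB : 2 * s%:R * p * a ^+ 2 <= B by rewrite a2 mulrC divfK// gt_eqF.
apply: le_ereal_inf_tmp => _ [fhat hfhat <-].
have [w hw] := hard_instance J0s s./2 a hfhat ns.
have -> : 16^-1 * (B / s%:R) = p * a ^+ 2 / 8.
  by rewrite a2; field; rewrite !gt_eqF.
apply: le_trans hw _.
apply: (@le_trans _ _ (ereal_sup [set risk P fhat (layer_fun J0 s./2 a w) | P in noise_class sigma2])).
  by apply: ereal_sup_ubound; exists zero_noise => //; exact: zero_noise_class.
apply: ereal_sup_ubound; exists (layer_fun J0 s./2 a w) => //.
exact: layer_fun_class.
Qed.

(** The three terms ensure, in this order, that 2^s >= 2 n, that s >= B^2, and that
the lower order terms are absorbed. *)
Definition log_threshold (C0 sigma2 eps B : R) : R :=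
  ln 2 / eps + B ^+ 2 + 4 * slack_threshold C0 sigma2 B.

Definition sample_threshold (C0 sigma2 eps B : R) : nat :=
  (32 + (Num.truncn (expR (log_threshold C0 sigma2 eps B))).+1)%N.

Lemma sample_threshold_spec C0 sigma2 eps B n s :
  0 < sigma2 -> 0 < eps -> 0 < B -> (sample_threshold C0 sigma2 eps B <= n)%N ->
  (1 + eps) * log2 n%:R <= s%:R ->
  [/\ (32 <= n)%N, (0 < s)%N, 4 * slack_threshold C0 sigma2 B <= ln n%:R,
      n%:R * (2 ^+ s)^-1 <= 2^-1 :> R & B ^+ 2 <= s%:R].
Proof.
move=> sg0 e0 B0 nT sn; have [L0 L1] := ln2_bounds.
have n32 : (32 <= n)%N by apply: leq_trans nT; rewrite leq_addr.
have n0 : (0 < n)%N by exact: leq_trans n32.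
have nR : 0 < n%:R :> R by rewrite ltr0n.
have T1 : 0 <= slack_threshold C0 sigma2 B.
  have C1 := size_factor_ge1 C0; have l0 := inv_temperature_gt0 sg0.
  apply: divr_ge0; last by apply: mulr_ge0; exact: ltW.
  apply: mulr_ge0; last by lra.
  apply: addr_ge0; last by apply: divr_ge0; rewrite ?ler0n ?ltW.
  by apply: mulr_ge0; rewrite ?ler0n ?expR_ge0.
have T2 : 0 <= ln 2 / eps by rewrite divr_ge0// ltW.
have T3 := sqr_ge0 B.
have lnT : log_threshold C0 sigma2 eps B <= ln n%:R.
  rewrite -ler_expR lnK ?posrE//; apply: ltW.
  apply: lt_le_trans (truncnS_gt _) _; rewrite ler_nat.
  by apply: leq_trans nT; rewrite leq_addl.
rewrite /log_threshold in lnT.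
have tn : 0 < ln n%:R :> R by rewrite ln_gt0// ltr1n (leq_trans _ n32).
have sL : (1 + eps) * ln n%:R <= ln 2 * s%:R.
  have -> : (1 + eps) * ln n%:R = ln 2 * ((1 + eps) * log2 n%:R).
    by rewrite /log2; field; rewrite gt_eqF.
  by rewrite ler_pM2l.
have en : ln 2 <= eps * ln n%:R.
  by rewrite mulrC -ler_pdivrMr//; lra.
have s0 : (0 < s)%N.
  rewrite -(ltr0n R) -(pmulr_rgt0 _ L0); apply: lt_le_trans sL.
  by rewrite mulr_gt0//; lra.
have sR : 0 < s%:R :> R by rewrite ltr0n.
split => //; first lra.
  rewrite ler_pdivrMr ?exprn_gt0//.
  have -> : 2^-1 * 2 ^+ s = expR (ln 2 * s%:R - ln 2) :> R.
    by rewrite expRD expRN expRM_natr !lnK ?posrE// mulrC.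
  rewrite -[leLHS]lnK ?posrE// ler_expR; lra.
have : ln 2 * s%:R <= s%:R :> R by rewrite -[leRHS]mul1r ler_pM2r.
have : 0 <= eps * ln n%:R by rewrite mulr_ge0// ltW.
lra.
Qed.

End Asymptotics.


Theorem theorem4p5 (R : realType) (C0 : R) :
  exists eta : R, 0 < eta < 2^-1 /\
  forall sigma2 eps : R, 0 < sigma2 -> 0 < eps ->
  exists (c C : R) (n0 : R -> nat), [/\ 0 < c, c < C,
    forall (B : R) (n s d : nat), 0 < B -> (n0 B <= n)%N ->
      (1 + eps) * log2 n%:R <= s%:R <= C0 * log2 n%:R -> (s <= d)%N ->
      let M := @monotone_class R d B s in
      let upper := C * (B / s%:R + ln ('C(d, s)%:R) / n%:R) in
      [/\ ((c * (B / s%:R))%:E <= minimax_risk sigma2 n M)%E,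
          (minimax_risk sigma2 n M <= upper%:E)%E &
          let D := Num.truncn (eta * s%:R) in
          forall Jhat : n.-tuple (cube d) -> n.-tuple R -> {set 'I_d},
            is_selector s D Jhat ->
            (worst_risk sigma2 M (model_selection_estimator D Jhat)
               <= upper%:E)%E] &
    forall A1 : R, exists c' C' : R, [/\ 0 < c', 0 < C' &
      forall (B : R) (n s d : nat), 0 < B -> (n0 B <= n)%N ->
        (1 + eps) * log2 n%:R <= s%:R <= C0 * log2 n%:R -> (s <= d)%N ->
        ln ('C(d, s)%:R) <= A1 * (n%:R * B / s%:R) ->
        let M := @monotone_class R d B s in
        ((c' * (B / s%:R))%:E <= minimax_risk sigma2 n M)%E /\
        (minimax_risk sigma2 n M <= (C' * (B / s%:R))%:E)%E]].
Proof.
exists (degree_ratio C0); split; first exact: degree_ratio_bounds.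
move=> sigma2 eps sg0 e0.
exists 16^-1, (upper_factor C0 sigma2), (sample_threshold C0 sigma2 eps).
have /andP[eta0 _] := degree_ratio_bounds C0.
have C1 : 1 <= upper_factor C0 sigma2.
  have := divr_gt0 (ltr0n R 3) eta0; have := divr_gt0 (ltr0n R 8) (inv_temperature_gt0 sg0).
  by rewrite /upper_factor; lra.
have bounds (B : R) (n s d : nat) : 0 < B -> (sample_threshold C0 sigma2 eps B <= n)%N ->
    (1 + eps) * log2 n%:R <= s%:R <= C0 * log2 n%:R -> (s <= d)%N ->
    [/\ ((16^-1 * (B / s%:R))%:E <= minimax_risk sigma2 n (@monotone_class R d B s))%E,
        (minimax_risk sigma2 n (@monotone_class R d B s) <=
          (upper_factor C0 sigma2 * (B / s%:R + ln ('C(d, s)%:R) / n%:R))%:E)%E &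
        forall Jhat : n.-tuple (cube d) -> n.-tuple R -> {set 'I_d},
          is_selector s (Num.truncn (degree_ratio C0 * s%:R)) Jhat ->
          (worst_risk sigma2 (@monotone_class R d B s)
             (model_selection_estimator (Num.truncn (degree_ratio C0 * s%:R)) Jhat)
           <= (upper_factor C0 sigma2 * (B / s%:R + ln ('C(d, s)%:R) / n%:R))%:E)%E].
  move=> B0 nT /andP[sn sC] sd.
  have [n32 s0 thr ns Bs] := sample_threshold_spec sg0 e0 B0 nT sn.
  have upper Jhat := @model_selection_upper R C0 sigma2 B n s d Jhat sg0 B0 n32 s0 sd sC thr.
  split => //; first exact: minimax_lower (ltW sg0) B0 s0 sd ns Bs.
  have [Jhat sel] := @selector_exists R n d s (Num.truncn (degree_ratio C0 * s%:R)) sd.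
  apply: le_trans (upper Jhat sel); apply: ereal_inf_lbound.
  by eexists; first exact: model_selection_is_estimator sel.
split => //; first by lra.
move=> A1; exists 16^-1, (upper_factor C0 sigma2 * (1 + `|A1|)).
have A0 := normr_ge0 A1.
split => //; first by rewrite mulr_gt0//; lra.
move=> B n s d B0 nT /[dup] sb /andP[sn _] sd lnA M.
have [lo up _] := bounds B n s d B0 nT sb sd; split => //.
have [n32 s0 _ _ _] := sample_threshold_spec sg0 e0 B0 nT sn.
have nR : 0 < n%:R :> R by rewrite ltr0n (leq_trans _ n32).
have sR : 0 < s%:R :> R by rewrite ltr0n.
apply: le_trans up _; rewrite lee_fin -mulrA ler_pM2l; last by lra.
rewrite mulrDl mul1r lerD2l ler_pdivrMr//; apply: le_trans lnA _.
have -> : A1 * (n%:R * B / s%:R) = A1 * (B / s%:R * n%:R) by ring.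
rewrite -[leRHS]mulrA; apply: ler_wpM2r; last exact: ler_norm.
by apply: mulr_ge0; [apply: divr_ge0; exact: ltW|exact: ltW].
Qed.
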